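(* Let $(y^*,u^*,z^*,p^*,\lambda^* )$ be the KKT point of the discretized problem $(\overline{\mathrm{DP}}_h)$ described in the context, and let $\{(u^k,z^k,\lambda^k)\}$ be the sequence generated by the inexact heterogeneous ADMM (ihADMM) algorithm described in the context, with associated states $\{y^k\}$ and adjoint states $\{p^k\}$. Then for any $\tau\in(0,1]$ and $\sigma\in(0,\tfrac14\alpha]$, $$\lim_{k\to\infty}\left\{\|u^k-u^*\|+\|z^k-z^*\|+\|\lambda^k-\lambda^*\|\right\}=0,$$ $$\lim_{k\to\infty}\left\{\|y^k-y^*\|+\|p^k-p^*\|\right\}=0.$$ Moreover, there exists a constant $C$ depending only on the initial point $(u^0,z^0,\lambda^0)$ and the optimal solution $(u^*,z^*,\lambda^* )$ (for fixed problem data, parameters $\sigma,\tau$ and tolerance sequence $\{\epsilon_k\}$) such that for all $k\ge1$, $$\min_{1\le i\le k}R_h(u^i,z^i,\lambda^i)\le\frac Ck,\qquad\text{and}\qquad \lim_{k\to\infty}\left(k\cdot\min_{1\le i\le k}R_h(u^i,z^i,\lambda^i)\right)=0,$$ where $R_h(u,z,\lambda)=\|M_h\lambda+\nabla f(u)\|^2+\mathrm{dist}^2(0,-M_h\lambda+\partial g(z))+\|u-z\|^2$.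
   Context: **Finite element matrices.** Let $n\in\{2,3\}$, let $\Omega\subset\mathbb R^n$ be a convex bounded open domain with $C^{1,1}$ or polygonal (polyhedral) boundary, and let $\mathcal T_h$ be a member of a regular, quasi-uniform family of triangulations, covering $\bar\Omega_h=\bigcup_{T\in\mathcal T_h}T$ with interior $\Omega_h\subset\Omega$. Let $\phi_1,\dots,\phi_{N_h}$ be the nodal basis (hat functions) of the space of continuous, piecewise affine functions on $\mathcal T_h$ that vanish on $\bar\Omega\setminus\Omega_h$. Let $a(y,v)=\int_{\Omega}\big(\sum_{i,j=1}^n a_{ij}y_{x_i}v_{x_j}+c_0yv\big)dx$ with $a_{ij},c_0\in L^\infty(\Omega)$, $a_{ij}=a_{ji}$, $c_0\ge0$, and $\sum_{i,j} a_{ij}(x)\xi_i\xi_j\ge\theta\|\xi\|^2$ for almost all $x\in\Omega$ and all $\xi\in\mathbb R^n$, for some $\theta>0$. Define $$K_h=(a(\phi_i,\phi_j))_{i,j=1}^{N_h},\quad M_h=\Big(\int_{\Omega_h}\phi_i\phi_j\,dx\Big)_{i,j=1}^{N_h},\quad W_h=\mathrm{diag}\Big(\int_{\Omega_h}\phi_i\,dx\Big)_{i=1}^{N_h}.$$ $K_h$ and $M_h$ are symmetric positive definite. It is known that $\|z\|_{M_h}^2\le\|z\|_{W_h}^2\le c\|z\|_{M_h}^2$ for all $z\in\mathbb R^{N_h}$, with $c=4$ if $n=2$ and $c=5$ if $n=3$. Here $\|z\|_B^2=\langle z,Bz\rangle$, and $\langle\cdot,\cdot\rangle$, $\|\cdot\|$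 are the Euclidean inner product and norm on $\mathbb R^{N_h}$. **Problem.** Let $\alpha,\beta>0$, $-\infty<a<0<b<\infty$, and $y_c,y_d\in\mathbb R^{N_h}$ (coefficient vectors). Problem $(\overline{\mathrm{DP}}_h)$ is $$\min_{(y,u,z)\in\mathbb R^{3N_h}}\ \tfrac12\|y-y_d\|_{M_h}^2+\tfrac\alpha4\|u\|_{M_h}^2+\tfrac\alpha4\|z\|_{W_h}^2+\beta\|W_hz\|_1\quad\text{s.t. } K_hy=M_h(u+y_c),\ u=z,\ z\in[a,b]^{N_h}.$$ Equivalently, minimize $f(u)+g(z)$ subject to $u=z$, where $$f(u)=\tfrac12\|K_h^{-1}M_h(u+y_c)-y_d\|_{M_h}^2+\tfrac\alpha4\|u\|_{M_h}^2,\qquad g(z)=\tfrac\alpha4\|z\|_{W_h}^2+\beta\|W_hz\|_1+\delta_{[a,b]^{N_h}}(z),$$ and $\delta_{[a,b]^{N_h}}$ is the indicator function ($0$ on the set, $+\infty$ outside). A KKT point $(y^*,u^*,z^*,p^*,\lambda^* )$ satisfies $K_hy^*=M_h(u^*+y_c)$, $K_hp^*=M_h(y_d-y^* )$, $-M_h\lambda^*=\nabla f(u^* )$ (that is, $\tfrac\alpha2M_hu^*-M_hp^*+M_h\lambda^*=0$), $M_h\lambda^*\in\partial g(z^* )$, and $u^*=z^*$. **ihADMM algorithm.** Let $\{\epsilon_k\}_{k\ge0}$ be a sequence of nonnegative numbers with $\sum_{k=0}^\infty\epsilon_k<\infty$ (hence $\sum_k\epsilon_k^2<\infty$). Given an initial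 point $z^0\in[a,b]^{N_h}$, $u^0,\lambda^0\in\mathbb R^{N_h}$ and parameters $\sigma,\tau>0$, for $k=0,1,2,\dots$ compute $$u^{k+1}=\arg\min_u\Big\{f(u)+\langle M_h\lambda^k,u-z^k\rangle+\tfrac\sigma2\|u-z^k\|_{M_h}^2-\langle\delta^k,u\rangle\Big\},$$ where the error vector $\delta^k\in\mathbb R^{N_h}$ satisfies $\|\delta^k\|\le\epsilon_k$, then $$z^{k+1}=\arg\min_z\Big\{g(z)+\langle M_h\lambda^k,u^{k+1}-z\rangle+\tfrac\sigma2\|u^{k+1}-z\|_{W_h}^2\Big\},\qquad \lambda^{k+1}=\lambda^k+\tau\sigma(u^{k+1}-z^{k+1}).$$ The associated state and adjoint state are $y^k=K_h^{-1}M_h(u^k+y_c)$ and $p^k=K_h^{-1}M_h(y_d-y^k)$. $\mathrm{dist}(0,S)$ is the Euclidean distance from $0$ to the set $S$, with $-M_h\lambda+\partial g(z)=\{-M_h\lambda+\varphi:\varphi\in\partial g(z)\}$. *)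

(* Defs.v *)
(* Vectors of R^n and R^N are column vectors 'cV[R]_n; the
   norm `|x| of the library on matrices is the max norm, so the Euclidean norm
   is [enorm] below.  Topological notions (open, closure, interior, continuity,
   boundedness, derivatives, limits) do not depend on the choice of the norm. *)
From HB Require Import structures.
From mathcomp Require Import all_boot all_order all_algebra.
From mathcomp Require Import all_classical all_reals all_analysis.

Set Implicit Arguments.
Unset Strict Implicit.
Unset Printing Implicit Defensive.

Import Order.TTheory GRing.Theory Num.Theory.
Import numFieldNormedType.Exports.

Local Open Scope classical_set_scope.
Local Open Scope ring_scope.

Section EuclideanSpace.
Context {R : realType}.

Definition dot {n : nat} (x y : 'cV[R]_n) : R := (x^T *m y) 0 0.

Definition enorm {n : nat} (x : 'cV[R]_n) : R := Num.sqrt (dot x x).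

Definition l1norm {n : nat} (x : 'cV[R]_n) : R := \sum_i `|x i 0|.

(* The squared weighted norm <z, B z>. *)
Definition wnorm2 {n : nat} (B : 'M[R]_n) (z : 'cV[R]_n) : R :=
  dot z (B *m z).

Definition unit_vec {n : nat} (i : 'I_n) : 'cV[R]_n := delta_mx i 0.

Definition gradient {n : nat} (f : 'cV[R]_n -> R) (x : 'cV[R]_n) : 'cV[R]_n :=
  \col_i 'D_(unit_vec i) f x.

Definition diameter {n : nat} (A : set 'cV[R]_n) : R :=
  sup [set enorm (p.1 - p.2) | p in A `*` A].

(* Extended-real valued, so that the distance to the empty set is +oo. *)
Definition dist0 {n : nat} (S : set 'cV[R]_n) : \bar R :=
  ereal_inf [set (enorm v)%:E | v in S].

Definition subdifferential {n : nat} (g : 'cV[R]_n -> \bar R) (z : 'cV[R]_n) :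
    set 'cV[R]_n :=
  [set v | forall w, (g z + (dot v (w - z))%:E <= g w)%E].

Definition minimizer {T : Type} {d} {S : porderType d} (F : T -> S) (x : T) :=
  forall y, (F x <= F y)%O.

End EuclideanSpace.

(* Lebesgue measure on R^n: the iterated product of the Lebesgue measure of the
   line, built on n-tuples (which carry the product sigma-algebra) and then
   transported to column vectors. *)
Section LebesgueTuple.
Context {R : realType}.
Local Notation mR := (measurableTypeR R).

Definition tuple_cons n (p : mR * n.-tuple mR) : n.+1.-tuple mR :=
  [tuple of p.1 :: p.2].

Lemma measurable_tuple_cons n : measurable_fun setT (@tuple_cons n).
Proof.
exact: (@measurable_cons _ _ _ mR fst n snd measurable_fst measurable_snd).
Qed.

Section Cons.
Variables (n : nat) (mu : {sigma_finite_measure set (n.-tuple mR) -> \bar R}).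

Definition cons_measure : set (n.+1.-tuple mR) -> \bar R :=
  pushforward (@lebesgue_measure R \x mu)%E (@tuple_cons n).

Let mpre A : measurable A -> measurable (@tuple_cons n @^-1` A).
Proof. by move=> mA; rewrite -[X in measurable X]setTI; exact: measurable_tuple_cons. Qed.

Let cons_measure0 : cons_measure set0 = 0%E.
Proof. by rewrite /cons_measure /pushforward preimage_set0 measure0. Qed.

Let cons_measure_ge0 A : (0 <= cons_measure A)%E.
Proof. by rewrite /cons_measure /pushforward measure_ge0. Qed.

Let cons_measure_sigma_additive : semi_sigma_additive cons_measure.
Proof.
move=> F mF tF mUF; rewrite /cons_measure /pushforward preimage_bigcup.
apply: measure_semi_sigma_additive => [i||].
- exact: mpre.
- apply/trivIsetP => /= i j _ _ ij; rewrite -preimage_setI.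
  by move/trivIsetP : tF => /(_ _ _ _ _ ij) ->//; rewrite preimage_set0.
- by rewrite -preimage_bigcup; exact: mpre.
Qed.

HB.instance Definition _ := isMeasure.Build _ _ _ cons_measure
  cons_measure0 cons_measure_ge0 cons_measure_sigma_additive.

Let cons_measure_sigma_finite : sigma_finite setT cons_measure.
Proof.
pose uncons (t : n.+1.-tuple mR) : mR * n.-tuple mR :=
  (thead t, [tuple of behead t]).
have unconsK p : uncons (@tuple_cons n p) = p.
  by case: p => x t; rewrite /uncons /= theadE; congr pair; exact/val_inj.
have preK A : @tuple_cons n @^-1` (uncons @^-1` A) = A.
  by apply/funext => p /=; rewrite unconsK.
have muncons : measurable_fun setT uncons.
  apply/measurable_fun_pairP; split.
  - exact: measurable_tnth.
  - exact: measurable_behead.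
have /sigma_finiteP[F [TF ndF Foo]] := sigma_finiteT (@lebesgue_measure R).
have /sigma_finiteP[G [TG ndG Goo]] := sigma_finiteT mu.
exists (fun k => uncons @^-1` (F k `*` G k)).
  rewrite -preimage_bigcup -(preimage_setT uncons); congr (_ @^-1` _).
  rewrite -setXTT TF TG predeqE => -[x y]; split.
    move=> [/= [i _ Fix] [k _ Gky]]; exists (maxn i k) => //; split.
    - by move: x Fix; exact/subsetPset/ndF/leq_maxl.
    - by move: y Gky; exact/subsetPset/ndG/leq_maxr.
  by move=> [i _ []/= ? ?]; split; exists i.
move=> k; have [mF Fk] := Foo k; have [mG Gk] := Goo k; split.
  by rewrite -[X in measurable X]setTI; apply: muncons => //; exact: measurableX.
rewrite /cons_measure /pushforward preK product_measure1E//.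
by rewrite lte_mul_pinfty// ge0_fin_numE.
Qed.

HB.instance Definition _ := Measure_isSigmaFinite.Build _ _ _ cons_measure
  cons_measure_sigma_finite.

End Cons.

Fixpoint tuple_lebesgue n : {sigma_finite_measure set (n.-tuple mR) -> \bar R} :=
  match n with
  | 0 => dirac [tuple]
  | m.+1 => cons_measure (tuple_lebesgue m)
  end.

End LebesgueTuple.

Section LebesgueVector.
Context {R : realType} {n : nat}.
Local Notation mR := (measurableTypeR R).

Definition vec_of_tuple (t : n.-tuple mR) : 'cV[R]_n := \col_i tnth t i.

(* [vec_of_tuple] is a bijection, hence this is the product sigma-algebra,
   i.e. the Borel sigma-algebra of R^n. *)
Definition vec_measurable : set (set 'cV[R]_n) :=
  [set A | measurable (vec_of_tuple @^-1` A)].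

Let vec_measurable0 : vec_measurable set0.
Proof. by rewrite /vec_measurable /= preimage_set0. Qed.

Let vec_measurableC A : vec_measurable A -> vec_measurable (~` A).
Proof. by rewrite /vec_measurable /= preimage_setC; exact: measurableC. Qed.

Let vec_measurable_bigcup (F : (set 'cV[R]_n)^nat) :
  (forall i, vec_measurable (F i)) -> vec_measurable (\bigcup_i F i).
Proof.
by move=> mF; rewrite /vec_measurable /= preimage_bigcup; exact: bigcupT_measurable.
Qed.

HB.instance Definition _ := @isMeasurable.Build default_measure_display
  'cV[R]_n vec_measurable vec_measurable0 vec_measurableC vec_measurable_bigcup.

Definition lebesgue_vec : set 'cV[R]_n -> \bar R :=
  pushforward (tuple_lebesgue n) vec_of_tuple.

Let lebesgue_vec0 : lebesgue_vec set0 = 0%E.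
Proof. by rewrite /lebesgue_vec /pushforward preimage_set0 measure0. Qed.

Let lebesgue_vec_ge0 A : (0 <= lebesgue_vec A)%E.
Proof. by rewrite /lebesgue_vec /pushforward measure_ge0. Qed.

Let lebesgue_vec_sigma_additive : semi_sigma_additive lebesgue_vec.
Proof.
move=> F mF tF mUF; rewrite /lebesgue_vec /pushforward preimage_bigcup.
apply: measure_semi_sigma_additive => [i||].
- exact: mF.
- apply/trivIsetP => /= i j _ _ ij; rewrite -preimage_setI.
  by move/trivIsetP : tF => /(_ _ _ _ _ ij) ->//; rewrite preimage_set0.
- by rewrite -preimage_bigcup; exact: mUF.
Qed.

HB.instance Definition _ := isMeasure.Build _ _ _ lebesgue_vec
  lebesgue_vec0 lebesgue_vec_ge0 lebesgue_vec_sigma_additive.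

End LebesgueVector.

Section Domain.
Context {R : realType} {n : nat}.
Implicit Type Omega : set 'cV[R]_n.

Definition polyhedral Omega : Prop :=
  exists (m : nat) (nu : 'I_m -> 'cV[R]_n) (c : 'I_m -> R),
    Omega = [set x | forall i, dot (nu i) x < c i].

Definition C11_function {m : nat} (gamma : 'cV[R]_m -> R) : Prop :=
  (forall x, differentiable gamma x) /\
  exists L : R, forall x y,
    enorm (gradient gamma x - gradient gamma y) <= L * enorm (x - y).

(* Near each boundary point, in suitable orthonormal coordinates, Omega is the
   strict epigraph of a C^{1,1} function of the coordinates other than j. *)
Definition C11_boundary Omega : Prop :=
  forall x, (closure Omega `\` Omega) x ->
  exists (r : R) (Q : 'M[R]_n) (j : 'I_n) (gamma : 'cV[R]_n.-1 -> R),
    [/\ 0 < r, Q^T *m Q = 1%:M, C11_function gamma &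
        forall y, enorm (y - x) < r ->
          (Omega y <-> gamma (row' j (Q *m y)) < (Q *m y) j 0)].

Definition admissible_domain Omega : Prop :=
  [/\ Omega !=set0, open Omega, bounded_set Omega,
      convex_set (Omega : set (convex_lmodType 'cV[R]_n)) &
      C11_boundary Omega \/ polyhedral Omega].

End Domain.

Section Triangulation.
Context {R : realType} {n : nat}.

Section Simplex.
Variables (m : nat) (vert : 'I_m -> 'cV[R]_n).

Definition simplex (S : {set 'I_m}) : set 'cV[R]_n :=
  [set x | exists w : 'I_m -> R,
     [/\ forall i, 0 <= w i, forall i, i \notin S -> w i = 0,
         \sum_i w i = 1 & x = \sum_i w i *: vert i]].

Definition affinely_independent (S : {set 'I_m}) : Prop :=
  forall w : 'I_m -> R, (forall i, i \notin S -> w i = 0) ->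
    \sum_i w i = 0 -> \sum_i w i *: vert i = 0 -> forall i, w i = 0.

End Simplex.

(* A conforming simplicial mesh; a cell is given by its set of vertices. *)
Record triangulation := Triangulation {
  nverts : nat;
  vert : 'I_nverts -> 'cV[R]_n;
  cells : {set {set 'I_nverts}};
  vert_inj : injective vert;
  vert_used : forall i, exists2 S, S \in cells & i \in S;
  card_cell : forall S, S \in cells -> #|S| = n.+1;
  cell_nondegenerate :
    forall S, S \in cells -> affinely_independent vert S;
  conforming : forall S T, S \in cells -> T \in cells ->
    simplex vert S `&` simplex vert T = simplex vert (S :&: T)%SET
}.

Definition cell_set (Th : triangulation) (S : {set 'I_(nverts Th)}) :
  set 'cV[R]_n := simplex (@vert Th) S.

Definition closed_mesh_domain (Th : triangulation) : set 'cV[R]_n :=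
  [set x | exists2 S, S \in cells Th & @cell_set Th S x].

Definition mesh_domain (Th : triangulation) : set 'cV[R]_n :=
  interior (closed_mesh_domain Th).

(* Regular: the diameter of a cell is at most kappa times the diameter of some
   ball contained in it.  Quasi-uniform: the mesh size (the largest diameter of
   a cell) is at most tau times the diameter of any cell.  The constants are
   shared by all the meshes of the family. *)
Definition regular_quasi_uniform (H : Type) (Th : H -> triangulation) : Prop :=
  exists kappa tau : R, forall h S, S \in cells (Th h) ->
    (exists (x : 'cV[R]_n) (r : R),
       [/\ 0 < r, [set y | enorm (y - x) <= r] `<=` @cell_set (Th h) S &
           diameter (@cell_set (Th h) S) <= kappa * (2 * r)]) /\
    (forall S', S' \in cells (Th h) ->
       diameter (@cell_set (Th h) S') <= tau * diameter (@cell_set (Th h) S)).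

(* Only the values on the closure of Omega matter. *)
Definition fe_space (Omega : set 'cV[R]_n) (Th : triangulation)
    (v : 'cV[R]_n -> R) : Prop :=
  [/\ {within closure Omega, continuous v},
      forall S, S \in cells Th -> exists (c : R) (g : 'cV[R]_n),
        forall x, @cell_set Th S x -> v x = c + dot g x &
      forall x, (closure Omega `\` mesh_domain Th) x -> v x = 0].

(* [node] enumerates the vertices lying in the open set Omega_h; the functions
   of [fe_space] vanish at all the other vertices. *)
Definition nodal_basis (Omega : set 'cV[R]_n) (Th : triangulation) (N : nat)
    (node : 'I_N -> 'I_(nverts Th)) (phi : 'I_N -> 'cV[R]_n -> R) : Prop :=
  [/\ injective node,
      forall v, mesh_domain Th (vert v) <-> exists i, node i = v,
      forall i, fe_space Omega Th (phi i) &
      forall i j, phi i (vert (node j)) = (i == j)%:R].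

End Triangulation.

Arguments triangulation R n : clear implicits.

Section EllipticForm.
Context {R : realType} {n : nat}.
Local Notation leb := (@lebesgue_vec R n).

Definition Linfty (Omega : set 'cV[R]_n) (f : 'cV[R]_n -> R) : Prop :=
  measurable_fun Omega f /\
  exists B : R, {ae leb, forall x, Omega x -> `|f x| <= B}.

Definition elliptic_coefficients (Omega : set 'cV[R]_n)
    (A : 'I_n -> 'I_n -> 'cV[R]_n -> R) (c0 : 'cV[R]_n -> R) (theta : R) : Prop :=
  [/\ (forall i j, Linfty Omega (A i j)) /\ Linfty Omega c0,
      forall i j, {ae leb, forall x, Omega x -> A i j x = A j i x},
      {ae leb, forall x, Omega x -> 0 <= c0 x},
      0 < theta &
      {ae leb, forall x, Omega x -> forall xi : 'cV[R]_n,
         theta * enorm xi ^+ 2 <=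
         \sum_i \sum_j A i j x * xi i 0 * xi j 0}].

(* Used only on continuous piecewise affine functions: their weak partial
   derivatives are the classical ones, which exist off the union of the faces
   of the mesh, a null set. *)
Definition energy_form (Omega : set 'cV[R]_n)
    (A : 'I_n -> 'I_n -> 'cV[R]_n -> R) (c0 : 'cV[R]_n -> R)
    (y v : 'cV[R]_n -> R) : R :=
  \int[leb]_(x in Omega)
    (\sum_i \sum_j A i j x * 'D_(unit_vec i) y x * 'D_(unit_vec j) v x
     + c0 x * y x * v x).

Definition stiffness_matrix Omega A c0 (N : nat)
    (phi : 'I_N -> 'cV[R]_n -> R) : 'M[R]_N :=
  \matrix_(i, j) energy_form Omega A c0 (phi i) (phi j).

Definition mass_matrix (Th : triangulation R n) (N : nat)
    (phi : 'I_N -> 'cV[R]_n -> R) : 'M[R]_N :=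
  \matrix_(i, j) \int[leb]_(x in mesh_domain Th) (phi i x * phi j x).

Definition lumped_mass_matrix (Th : triangulation R n) (N : nat)
    (phi : 'I_N -> 'cV[R]_n -> R) : 'M[R]_N :=
  diag_mx (\row_i \int[leb]_(x in mesh_domain Th) phi i x).

End EllipticForm.

Section ControlProblem.
Context {R : realType} {N : nat}.
Variables (K M W : 'M[R]_N) (alpha beta a b : R) (yc yd : 'cV[R]_N).
Implicit Types u z lambda y p : 'cV[R]_N.

Definition state u : 'cV[R]_N := invmx K *m (M *m (u + yc)).

Definition adjoint_state y : 'cV[R]_N := invmx K *m (M *m (yd - y)).

Definition in_box z : bool := [forall i, a <= z i 0 <= b].

Definition f_obj u : R :=
  2^-1 * wnorm2 M (state u - yd) + alpha / 4 * wnorm2 M u.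

Definition g_obj z : \bar R :=
  if in_box z then (alpha / 4 * wnorm2 W z + beta * l1norm (W *m z))%:E
  else +oo%E.

Definition KKT_point y u z p lambda : Prop :=
  [/\ K *m y = M *m (u + yc),
      K *m p = M *m (yd - y),
      - (M *m lambda) = gradient f_obj u,
      subdifferential g_obj z (M *m lambda) &
      u = z].

Variables (sigma tau : R).

Definition u_objective (delta lambda z u : 'cV[R]_N) : R :=
  f_obj u + dot (M *m lambda) (u - z) + sigma / 2 * wnorm2 M (u - z)
  - dot delta u.

Definition z_objective (lambda u z : 'cV[R]_N) : \bar R :=
  (g_obj z + (dot (M *m lambda) (u - z) + sigma / 2 * wnorm2 W (u - z))%:E)%E.

(* [u], [z], [lambda] are iterates of the method for the tolerances [eps];
   [delta] is the sequence of error vectors. *)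
Definition ihADMM (eps : nat -> R) (delta u z lambda : nat -> 'cV[R]_N) : Prop :=
  in_box (z 0) /\
  forall k,
    [/\ enorm (delta k) <= eps k,
        minimizer (u_objective (delta k) (lambda k) (z k)) (u k.+1),
        minimizer (z_objective (lambda k) (u k.+1)) (z k.+1) &
        lambda k.+1 = lambda k + (tau * sigma) *: (u k.+1 - z k.+1)].

Definition KKT_residual u z lambda : \bar R :=
  ((enorm (M *m lambda + gradient f_obj u) ^+ 2)%R%:E
   + dist0 [set (- (M *m lambda) + v)%R | v in subdifferential g_obj z] ^+ 2
   + (enorm (u - z)%R ^+ 2)%R%:E)%E.

(* min of [r i] over 1 <= i <= k. *)
Definition best_residual (r : nat -> \bar R) (k : nat) : \bar R :=
  (\big[Order.min/+oo]_(1 <= i < k.+1) r i)%E.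

End ControlProblem.

(* Main.v *)
From HB Require Import structures.
Require Import Defs.
From mathcomp Require Import all_boot all_order all_algebra.
From mathcomp Require Import all_classical all_reals all_analysis.
From mathcomp Require Import measurable_realfun ring lra.
Import Order.TTheory GRing.Theory Num.Theory.
Import numFieldNormedType.Exports.

(** The proof has two independent halves.

    Iteration.  Write u, z, l for the errors of the iterates and D = W - M.
    Strong convexity of f in the M-norm and of g in the W-norm, applied to the
    optimality conditions of the two subproblems ([u_step], [z_step]),
    shows that the Lyapunov function
    [m l / (2 * (tau * sigma)) + sigma / 2 * m z], with [m x = <x, M x>],
    decreases at each step by at least a multiple of [m u + <z, W z>], up to the
    term <delta, u> ([step_descent]).  Since the z-step is regularized by W
    instead of M, an extra term sigma (<u, D z> - <z, D z>) appears; it is at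
    most sigma / 4 <u, D u>, and the strong convexity absorbs it as soon as W is
    at most 8 M and sigma is at most alpha / 4.  Young's inequality turns
    <delta, u> into a fraction of the decrease plus a constant times
    eps_k ^ 2, which is summable.  Hence the squared errors of u and z are
    summable ([admm_summable]); so are those of the multipliers, because the
    u-step expresses M l by the other errors ([multiplier_bound]); and the KKT
    residual is bounded by squared errors ([residual_bound]).  For a summable
    nonnegative sequence the running minimum is O(1/k) and o(1/k)
    ([best_residual_rate]).

    Matrices.  It remains to see that M is symmetric positive definite, that
    M <= W <= 8 M as quadratic forms, and that K is invertible.  All of this is
    read off cell by cell.  For the mass matrices, moments of the barycentric
    coordinates of a simplex are needed; they are obtained from the
    self-similarity of the simplex under homotheties centred at its vertices
    ([first_moment], [second_moment_ge]), so that the only change of variables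
    is x |-> p + s x.  The same argument shows that faces are negligible
    ([face_null]).  For the stiffness matrix, ellipticity bounds the quadratic
    form from below by the squared gradients on the cells ([stiffness_ge]); a
    finite element function whose gradient vanishes on every cell takes finitely
    many values, and continuity along a ray towards the boundary of the domain
    forces it to be zero ([fe_fun_slope0]). *)

Set Implicit Arguments.
Unset Strict Implicit.
Unset Printing Implicit Defensive.
Local Open Scope classical_set_scope.
Local Open Scope ring_scope.

(** * Euclidean inner product and quadratic forms *)

Section DotAlgebra.
Context {R : realType} {N : nat}.
Local Notation V := ('cV[R]_N).
Implicit Types (x y z : V) (B : 'M[R]_N).

Lemma dotE x y : dot x y = \sum_i x i 0 * y i 0.
Proof. by rewrite /dot mxE; apply: eq_bigr => i _; rewrite mxE. Qed.

Lemma dotC x y : dot x y = dot y x.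
Proof. by rewrite /dot !mxE; apply: eq_bigr => i _; rewrite !mxE mulrC. Qed.
Lemma dotDl x y z : dot (x + y) z = dot x z + dot y z.
Proof. by rewrite /dot linearD mulmxDl mxE. Qed.
Lemma dotDr x y z : dot z (x + y) = dot z x + dot z y.
Proof. by rewrite /dot mulmxDr mxE. Qed.
Lemma dotZl a x z : dot (a *: x) z = a * dot x z.
Proof. by rewrite /dot linearZ/= -scalemxAl mxE. Qed.
Lemma dotZr a x z : dot z (a *: x) = a * dot z x.
Proof. by rewrite /dot -scalemxAr mxE. Qed.
Lemma dotNl x z : dot (- x) z = - dot x z.
Proof. by rewrite -scaleN1r dotZl mulN1r. Qed.
Lemma dotNr x z : dot z (- x) = - dot z x.
Proof. by rewrite -scaleN1r dotZr mulN1r. Qed.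
Lemma dot_trmx B x y : dot (B *m x) y = dot x (B^T *m y).
Proof. by rewrite /dot trmx_mul mulmxA. Qed.
Definition dot_lin := (dotDl, dotDr, dotNl, dotNr, dotZl, dotZr).

Lemma dot_unit x i : dot x (unit_vec i) = x i 0.
Proof.
rewrite /dot mxE (bigD1 i)//= !mxE !eqxx mulr1 big1 ?addr0// => k /negbTE ki.
by rewrite !mxE ki mulr0.
Qed.

Lemma dot_ge0 x : 0 <= dot x x.
Proof. by rewrite /dot mxE sumr_ge0// => i _; rewrite mxE -expr2 sqr_ge0. Qed.

Lemma dot_eq0 x : dot x x = 0 -> x = 0.
Proof.
rewrite /dot mxE => h; apply/colP => i; rewrite [RHS]mxE.
have := psumr_eq0P _ h => /(_ _ i isT); rewrite mxE -expr2 => h2.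
by apply/eqP; rewrite -sqrf_eq0 h2// => j _; rewrite mxE -expr2 sqr_ge0.
Qed.

Lemma enorm_sqr x : enorm x ^+ 2 = dot x x.
Proof. by rewrite /enorm sqr_sqrtr// dot_ge0. Qed.

Lemma coord_le_enorm x i : `|x i 0| <= enorm x.
Proof.
rewrite -(@ler_pXn2r _ 2)// ?nnegrE ?normr_ge0 ?sqrtr_ge0// enorm_sqr real_normK ?num_real//.
rewrite /dot mxE (bigD1 i)//= mxE -expr2 lerDl sumr_ge0// => j _.
by rewrite mxE -expr2 sqr_ge0.
Qed.

(** Each entry of [B *m x] is at most a row sum of absolute values times the
    norm of x. *)
Lemma mulmx_bounded B : exists2 C : R, 0 <= C & forall x, dot (B *m x) (B *m x) <= C * dot x x.
Proof.
exists (\sum_i (\sum_j `|B i j|) ^+ 2); first by apply: sumr_ge0 => i _; exact: sqr_ge0.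
move=> x; rewrite {1}/dot mxE mulr_suml; apply: ler_sum => i _.
rewrite [(_ ^T) _ _]mxE -expr2 -enorm_sqr -exprMn -real_normK ?num_real//.
rewrite ler_pXn2r ?nnegrE ?mulr_ge0 ?sumr_ge0 ?sqrtr_ge0//.
rewrite mxE (le_trans (ler_norm_sum _ _ _))// mulr_suml ler_sum// => j _.
by rewrite normrM ler_wpM2l// coord_le_enorm.
Qed.

Lemma dot_mulmx_bounded B : exists2 C : R, 0 < C & forall x, dot x (B *m x) <= C * dot x x.
Proof.
have [C C0 hC] := mulmx_bounded B; exists (1 + C); first by rewrite ltr_wpDr.
move=> x; have := dot_ge0 (B *m x - x); have := hC x; have := dot_ge0 x.
rewrite !dot_lin (dotC (B *m x) x).
have := mulr_ge0 C0 (dot_ge0 x); nra.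
Qed.

Lemma dot_sum3 x y z : dot (x + y + z) (x + y + z) <= 3 * (dot x x + dot y y + dot z z).
Proof.
have := dot_ge0 (x - y); have := dot_ge0 (x - z); have := dot_ge0 (y - z).
rewrite !dot_lin (dotC y x) (dotC z x) (dotC z y); lra.
Qed.

Lemma dot_sum2 x y : dot (x + y) (x + y) <= 2 * (dot x x + dot y y).
Proof. by have := dot_ge0 (x - y); rewrite !dot_lin (dotC y x); lra. Qed.

Lemma wnorm2E B z : wnorm2 B z = \sum_i \sum_j (z i 0 * z j 0) * B i j.
Proof.
rewrite /wnorm2 dotE; apply: eq_bigr => i _; rewrite mxE mulr_sumr.
by apply: eq_bigr => j _; ring.
Qed.
End DotAlgebra.

Lemma trivial_kernel_unitmx {R : realType} {N : nat} (B : 'M[R]_N) :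
  (forall x : 'cV[R]_N, B *m x = 0 -> x = 0) -> B \in unitmx.
Proof.
move=> B0; rewrite -unitmx_tr -row_free_unit; apply: inj_row_free => v vB.
have /(congr1 trmx) : v^T = 0 by apply: B0; rewrite -[B]trmxK -trmx_mul vB trmx0.
by rewrite trmxK trmx0.
Qed.

(** * One-variable inequalities and derivatives *)

Section FirstOrderConditions.
Context {R : realType}.

(** The first order condition for an unconstrained quadratic minimum at 0. *)
Lemma quadratic_min_linear0 (c q : R) : (forall h, 0 <= h * c + h ^+ 2 * q) -> c = 0.
Proof.
move=> hq; apply/eqP/negPn/negP => c0.
have Q0 : 0 < `|q| + 1 by rewrite ltr_wpDl.
have := hq (- c / (2 * (`|q| + 1))).
have -> : - c / (2 * (`|q| + 1)) * c + (- c / (2 * (`|q| + 1))) ^+ 2 * q =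
  - (c ^+ 2 * (2 * (`|q| + 1) - q) / (2 * (`|q| + 1)) ^+ 2) by field; rewrite lt0r_neq0.
rewrite oppr_ge0 leNgt => /negP; apply.
have := ler_norm q => qn.
have c2 : 0 < c ^+ 2 by rewrite lt0r sqrf_eq0 c0 sqr_ge0.
apply: divr_gt0; last by apply: exprn_gt0; lra.
by apply: mulr_gt0 => //; lra.
Qed.

(** The first order condition along an admissible segment that starts at 0. *)
Lemma right_derivative_ge0 (c q : R) : (forall t, 0 < t <= 1 -> 0 <= t * c + t ^+ 2 * q) -> 0 <= c.
Proof.
move=> hq; rewrite leNgt; apply/negP => c0.
have Q0 : 0 < `|q| + 1 - c by have := normr_ge0 q; lra.
pose t := - c / (`|q| + 1 - c).
have t0 : 0 < t by rewrite divr_gt0// oppr_gt0.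
have t1 : t <= 1 by rewrite ler_pdivrMr// mul1r; have := normr_ge0 q; lra.
have := hq t; rewrite t0 t1 => /(_ isT).
have -> : t * c + t ^+ 2 * q = t * (c + t * q) by ring.
rewrite pmulr_rge0//.
have e : t * (`|q| + 1 - c) = - c by rewrite divfK ?lt0r_neq0.
have := ler_wpM2l (ltW t0) (ler_norm q) => h.
have := mulr_gt0 t0 (_ : 0 < 1 - c); lra.
Qed.
End FirstOrderConditions.

Section SmallPerturbations.
Context {R : realType}.

Lemma bernoulli_le m (s : R) : 0 <= s <= 1 -> 1 - s ^+ m <= m%:R * (1 - s).
Proof.
move=> /andP[s0 s1]; elim: m => [|m IH]; first by rewrite expr0 mul0r subrr.
rewrite exprS -natr1.
have := ler_wpM2l s0 IH; have := mulr_ge0 (ler0n R m) (mulr_ge0 (eqbRL (subr_ge0 _ _) s1) (eqbRL (subr_ge0 _ _) s1)); nra.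
Qed.

(** With [bernoulli_le], the expansion of [(1 - e) ^+ m] at e = 0 up to an
    error of order e ^ 2. *)
Lemma bernoulli2_ge m (e : R) : 0 < e < 1 -> m%:R * e - (m%:R * e) ^+ 2 <= 1 - (1 - e) ^+ m.
Proof.
move=> /andP[e0 e1]; elim: m => [|m IH]; first by rewrite expr0 !mul0r expr0n/= !subrr.
rewrite (exprS (1 - e)) -natr1; have m0 := ler0n R m; move: m%:R ((1 - e) ^+ m) m0 IH => t X m0 IH.
have e1' : 0 <= 1 - e by lra.
have := ler_wpM2l e1' IH.
have := mulr_ge0 (mulr_ge0 m0 m0) (exprn_ge0 3 (ltW e0)).
have := mulr_ge0 m0 (exprn_ge0 2 (ltW e0)).
have := exprn_ge0 2 (ltW e0); nra.
Qed.

Lemma le0_of_le_small (a C : R) : (forall e, 0 < e < 1 -> a <= e * C) -> a <= 0.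
Proof.
move=> h; rewrite leNgt; apply/negP => a0.
have C0 : 0 < C.
  have := h (1/2) ltac:(lra); lra.
have aC : 0 < a / (2 * (a + C)) < 1.
  rewrite divr_gt0 ?mulr_gt0 ?addr_gt0//= ltr_pdivrMr ?mulr_gt0 ?addr_gt0//; lra.
have := h _ aC; rewrite mulrAC ler_pdivlMr ?mulr_gt0 ?addr_gt0//; nra.
Qed.
End SmallPerturbations.

Section Derivative.
Context {R : realType} {n : nat}.
Local Notation V := ('cV[R]_n).

(** Serves both for the quadratic objective and, with q = 0, for functions that
    are affine near x. *)
Lemma derive_quadratic_near (f : V -> R) (x v : V) (c q : R) :
  (\forall h \near (0 : R), f (h *: v + x) - f x = h * c + h ^+ 2 * q) ->
  'D_v f x = c.
Proof.
move=> hf; rewrite /derive; apply: cvg_lim => //.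
have H : (fun h : R => c + h * q) @ 0^' --> c.
  apply: cvg_trans (_ : (fun h : R => c + h * q) @ (0 : R) --> c).
    exact: cvg_within_filter.
  have H : {for (0 : R), continuous (fun h : R => c + h * q)}.
    have H1 : {for (0 : R), continuous (fun h : R => h * q)}.
      exact: (continuousM (@cvg_id _ _) (@cst_continuous _ _ q 0)).
    exact: (continuousD (@cst_continuous _ _ c 0) H1).
  by move: H; rewrite /prop_for /continuous_at mul0r addr0.
apply: cvg_trans H; apply: near_eq_cvg.
rewrite !near_withinE/=; near=> h => h0 /=.
rewrite (_ : f (h *: v + x) - f x = h * c + h ^+ 2 * q); last by near: h.
by rewrite /GRing.scale/= mulrDr mulrA mulVf// mul1r expr2 !mulrA mulVf// mul1r.
Unshelve. all: by end_near. Qed.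

Lemma derive_affine_near (f : V -> R) (x : V) (i : 'I_n) (c : R) (g : V) :
  (\forall y \near x, f y = c + dot g y) -> 'D_(unit_vec i) f x = g i 0.
Proof.
move=> hf; apply: (@derive_quadratic_near _ _ _ _ 0).
have Hc : (fun h : R => h *: (unit_vec i : V) + x) @ (0 : R) --> x.
  have H : {for (0 : R), continuous (fun h : R => h *: (unit_vec i : V) + x)}.
    exact: (continuousD (@scalel_continuous _ _ (unit_vec i : V) 0) (@cst_continuous _ _ x 0)).
  by move: H; rewrite /prop_for /continuous_at scale0r add0r.
have := Hc _ hf; rewrite /= near_simpl /= => H.
near=> h.
rewrite (_ : f (h *: unit_vec i + x) = c + dot g (h *: unit_vec i + x)); last by near: h.
have -> : f x = c + dot g x by exact: (nbhs_singleton hf).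
have -> : dot g (h *: unit_vec i + x) = h * g i 0 + dot g x.
  rewrite !dotE (eq_bigr (fun k => h * (g k 0 * (k == i)%:R) + g k 0 * x k 0)); last first.
    by move=> k _; rewrite !mxE eqxx andbT; ring.
  rewrite big_split/= -mulr_sumr (bigD1 i)//= eqxx mulr1 big1 ?addr0// => k /negbTE ->.
  by rewrite mulr0.
by rewrite mulr0; ring.
Unshelve. all: by end_near. Qed.
End Derivative.

(** * Lebesgue measure on vectors: homotheties, balls, open sets *)

Section AffineLine.
Context {R : realType}.

(** Both sides are measures in A, so that half-open intervals suffice. *)
Lemma lebesgue_measure_affine (p s : R) (A : set (measurableTypeR R)) : 0 < s -> measurable A ->
  lebesgue_measure ((fun x : measurableTypeR R => p + s * x : measurableTypeR R) @^-1` A) = ((s^-1)%:E * lebesgue_measure A)%E.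
Proof.
move=> s0 mA.
pose phi := (fun x : measurableTypeR R => p + s * x : measurableTypeR R).
have mphi : measurable_fun setT phi.
  by apply: measurable_funD => //; exact: measurable_funM.
pose pf := measure_function_pushforward__canonical__measure_function_Measure lebesgue_measure mphi.
have s0' : 0 <= s by exact: ltW.
pose mu := mscale (NngNum s0') pf.
have -> : lebesgue_measure A = mu A.
  apply: lebesgue_measure_unique => // _ [[a b]] _ <-.
  transitivity (s%:E * lebesgue_measure (phi @^-1` `]a, b]%classic))%E; last by [].
  have -> : phi @^-1` `]a, b]%classic = `](a - p) / s, (b - p) / s]%classic.
    apply/seteqP; split => x /=; rewrite !in_itv/= ltr_pdivrMr// ler_pdivlMr// /phi (mulrC x);
    by move=> /andP[? ?]; apply/andP; split; lra.
  rewrite !lebesgue_measure_itv /= !lte_fin ltr_pM2r ?invr_gt0// ltrBlDr subrK.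
  case: ifP => ab; last by rewrite mule0.
  rewrite -!EFinD -EFinM; congr EFin; field; exact: lt0r_neq0.
transitivity ((s^-1)%:E * (s%:E * lebesgue_measure (phi @^-1` A)))%E; last by [].
rewrite muleA -EFinM mulVf ?mul1e//; exact: lt0r_neq0.
Qed.

Lemma ge0_integral_affine (p s : R) (f : measurableTypeR R -> \bar R) : 0 < s ->
  measurable_fun setT f -> (forall x, 0 <= f x)%E ->
  (\int[lebesgue_measure]_x f (p + s * x)%R = (s^-1)%:E * \int[lebesgue_measure]_x f x)%E.
Proof.
move=> s0 mf f0.
pose phi := (fun x : measurableTypeR R => p + s * x : measurableTypeR R).
have mphi : measurable_fun setT phi.
  by apply: measurable_funD => //; exact: measurable_funM.
pose pf := measure_function_pushforward__canonical__measure_function_Measure lebesgue_measure mphi.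
have s0' : 0 <= s^-1 by rewrite invr_ge0 ltW.
have /= := @ge0_integral_pushforward _ _ _ _ R _ mphi (@lebesgue_measure R) setT f measurableT mf.
rewrite preimage_setT => <- //.
pose nu := mscale (NngNum s0') (@lebesgue_measure R).
rewrite -(@ge0_integral_mscale _ _ _ (@lebesgue_measure R) _ measurableT (NngNum s0') f)//.
by apply: (@eq_measure_integral _ _ _ setT nu pf) => B mB _; exact: lebesgue_measure_affine.
Qed.

Definition tuple_affine {n} (p : n.-tuple R) (s : R) (t : n.-tuple R) : n.-tuple R :=
  [tuple tnth p i + s * tnth t i | i < n].

Lemma tuple_affine_cons n (p : n.+1.-tuple R) (s : R) x (t : n.-tuple R) :
  tuple_affine p s (tuple_cons (x, t)) =
  tuple_cons (thead p + s * x, tuple_affine [tuple of behead p] s t).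
Proof.
apply: eq_from_tnth => i; rewrite tnth_mktuple.
have [j ->|->] := unliftP ord0 i; last by rewrite !tnth0.
rewrite /tuple_cons !tnthS tnth_mktuple; congr (_ + _).
by rewrite tnth_behead; congr tnth; apply/val_inj; rewrite /= inordK// ltnS.
Qed.

Lemma measurable_tuple_affine n (p : n.-tuple R) (s : R) :
  measurable_fun setT (tuple_affine p s : n.-tuple (measurableTypeR R) -> n.-tuple (measurableTypeR R)).
Proof.
apply/measurable_fun_tnthP => i.
rewrite (_ : _ \o _ = (fun t : n.-tuple (measurableTypeR R) => tnth p i + s * tnth t i)); last first.
  by apply/funext => t /=; rewrite tnth_mktuple.
by apply: measurable_funD => //; apply: measurable_funM => //; exact: measurable_tnth.
Qed.

(** Slicing along the first coordinate leaves the same statement in one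
    dimension less and a change of variable on the line. *)
Lemma tuple_lebesgue_affine n (p : n.-tuple R) (s : R) (A : set (n.-tuple (measurableTypeR R))) :
  0 < s -> measurable A ->
  tuple_lebesgue n (tuple_affine p s @^-1` A) = ((s^-1 ^+ n)%:E * tuple_lebesgue n A)%E.
Proof.
elim: n p A => [|n IH] p A s0 mA.
  rewrite expr0 mul1e; congr (dirac _ _).
  by apply/funext => t /=; congr (A _); rewrite [t]tuple0 [LHS]tuple0.
have mphi B : measurable B -> measurable (@tuple_cons R n @^-1` B).
  by move=> mB; rewrite -[X in measurable X]setTI; exact: measurable_tuple_cons.
rewrite /= /cons_measure /pushforward /product_measure1.
pose g x := tuple_lebesgue n (xsection (@tuple_cons R n @^-1` A) x).
have mg : measurable_fun setT g.
  by apply: (measurable_fun_xsection (tuple_lebesgue n)); exact: mphi.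
have -> : (\int[lebesgue_measure]_x (tuple_lebesgue n \o
      xsection (@tuple_cons R n @^-1` (tuple_affine p s @^-1` A))) x =
   \int[lebesgue_measure]_x ((s^-1 ^+ n)%:E * g (thead p + s * x)%R))%E.
  apply: eq_integral => x _ /=; rewrite /g -(IH [tuple of behead p])//; last first.
    by apply: measurable_xsection; exact: mphi.
  congr (tuple_lebesgue n _); apply/funext => t; rewrite /= /xsection /= !in_setE /=.
  by rewrite tuple_affine_cons.
rewrite ge0_integralZl//; last 2 first.
- apply: measurableT_comp => //.
  by apply: measurable_funD => //; exact: measurable_funM.
- by rewrite lee_fin exprn_ge0// invr_ge0 ltW.
by rewrite ge0_integral_affine// muleA -EFinM exprSr.
Qed.
End AffineLine.

Section TupleBox.
Context {R : realType}.

Definition tuple_box {n} (c : n.-tuple R) (r : R) : set (n.-tuple (measurableTypeR R)) :=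
  [set t | forall i, ball (tnth c i) r (tnth t i)].

Lemma measurable_tuple_box n (c : n.-tuple R) r : measurable (tuple_box c r).
Proof.
have -> : tuple_box c r = \bigcap_(i in [set: 'I_n])
    ((fun t : n.-tuple (measurableTypeR R) => tnth t i) @^-1` ball (tnth c i) r).
  by apply/seteqP; split => t /= Ht i; [move=> _|]; exact: Ht.
apply: fin_bigcap_measurable => // i _.
rewrite -[X in measurable X]setTI; apply: measurable_tnth => //.
exact: measurable_ball.
Qed.

Lemma tuple_lebesgue_box n (c : n.-tuple R) r : 0 < r ->
  tuple_lebesgue n (tuple_box c r) = ((2 * r) ^+ n)%:E.
Proof.
move=> r0; elim: n c => [|n IH] c.
  rewrite /= expr0 diracE mem_set// => -[].
  by move=> m; case.
rewrite /= /cons_measure /pushforward.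
have -> : @tuple_cons R n @^-1` tuple_box c r =
   (ball (thead c) r : set (measurableTypeR R)) `*` tuple_box [tuple of behead c] r.
  apply/seteqP; split => -[x t] /=.
    move=> h; split; first by have := h ord0; rewrite tnth0.
    move=> i; have := h (lift ord0 i); rewrite tnthS tnth_behead.
    by congr (ball (tnth c _) _ _); apply/val_inj; rewrite /= inordK// ltnS.
  move=> [hx ht] i; case: (unliftP ord0 i) => [j ->|->]; last by rewrite tnth0.
  have := ht j; rewrite tnthS tnth_behead.
  by congr (ball (tnth c _) _ _); apply/val_inj; rewrite /= inordK// ltnS.
rewrite product_measure1E//; [|exact: measurable_ball|exact: measurable_tuple_box].
rewrite IH exprS EFinM mulr_natl; congr (_ * _)%E.
by apply: lebesgue_measure_ball; exact: ltW.
Qed.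
End TupleBox.

Section VectorMeasure.
Context {R : realType} {n : nat}.
Local Notation V := ('cV[R]_n).
Local Notation leb := (@lebesgue_vec R n).

Lemma measurable_coord (i : 'I_n) :
  measurable_fun setT (fun x : V => x i 0 : measurableTypeR R).
Proof.
move=> _ B mB; rewrite setTI.
suff : measurable ((fun t : n.-tuple (measurableTypeR R) => tnth t i) @^-1` B).
  by congr measurable; apply/funext => t; rewrite /= mxE.
by rewrite -[X in measurable X]setTI; exact: measurable_tnth.
Qed.

Lemma vec_ballP (c x : V) r : 0 < r ->
  ball c r x <-> forall i, `|c i 0 - x i 0| < r.
Proof.
move=> r0; split => [[_ h] i|h]; first exact: h.
by split => // i j; rewrite ord1; exact: h.
Qed.

Lemma vec_ball_box (c : V) r : 0 < r ->
  @vec_of_tuple R n @^-1` (ball c r) = tuple_box [tuple c i 0 | i < n] r.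
Proof.
move=> r0; apply/seteqP; split => t /=.
  by move/(vec_ballP _ _ r0) => h i; have := h i; rewrite tnth_mktuple mxE.
by move=> h; apply/(vec_ballP _ _ r0) => i; have := h i; rewrite tnth_mktuple mxE.
Qed.

Lemma measurable_vec_ball (c : V) r : 0 < r -> measurable (ball c r).
Proof.
move=> r0; rewrite /measurable /= /vec_measurable /= vec_ball_box//.
exact: measurable_tuple_box.
Qed.

Lemma lebesgue_vec_ball (c : V) r : 0 < r -> leb (ball c r) = ((2 * r) ^+ n)%:E.
Proof.
by move=> r0; rewrite /lebesgue_vec /pushforward vec_ball_box//; exact: tuple_lebesgue_box.
Qed.

(** Balls of the max norm are boxes; those with a rational centre and radius 1
    / (m + 1) form a countable base. *)
Lemma open_vec_measurable (A : set V) : open A -> measurable A.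
Proof.
move=> oA.
pose q (k : 'cV[rat]_n * nat) : set V := ball (map_mx ratr k.1 : V) (k.2.+1%:R^-1).
have -> : A = \bigcup_(k in [set k | q k `<=` A]) q k.
  apply/seteqP; split => [x Ax|x [k qA qx]]; last exact: qA.
  have /nbhs_ballP[e /= e0 eA] : nbhs x A by apply: open_nbhs_nbhs.
  have [m me] : exists m : nat, m.+1%:R^-1 < e / 2.
    have e20 : 0 < e / 2 by rewrite divr_gt0.
    have [m _ /(_ m (leqnn m))/=] := near_infty_natSinv_lt (PosNum e20).
    by exists m.
  have m0 : 0 < m.+1%:R^-1 :> R by rewrite invr_gt0.
  have h i : exists r : rat, `|x i 0 - ratr r| < m.+1%:R^-1.
    have [r] := @rat_in_itvoo R (x i 0) (x i 0 + m.+1%:R^-1) ltac:(by rewrite ltrDl).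
    rewrite in_itv/= => /andP[h1 h2]; exists r.
    rewrite ltr_norml; move: (m.+1%:R^-1) m0 h1 h2 => d d0 h1 h2.
    by apply/andP; split; lra.
  pose c : 'cV[rat]_n := \col_i projT1 (cid (h i)).
  have hc i : `|x i 0 - ratr (c i 0)| < m.+1%:R^-1.
    by rewrite mxE; case: (cid (h i)).
  exists (c, m) => /=; last first.
    by apply/vec_ballP => // i; rewrite mxE distrC; exact: hc.
  move=> y /(vec_ballP _ _ m0) hy; apply: eA; apply/vec_ballP => // i.
  have := hy i; rewrite mxE => hyi.
  have := hc i => hci; rewrite -(subrK (ratr (c i 0)) (x i 0)) -addrA.
  rewrite (le_lt_trans (ler_normD _ _))// (splitr e) ltrD// ; first exact: lt_trans me.
  exact: lt_trans me.
rewrite bigcup_mkcond; apply: countable_bigcupT_measurable => [|k]; first exact: countableP.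
by case: ifP => _; [exact: measurable_vec_ball|exact: measurable0].
Qed.

Lemma lebesgue_vec_open_gt0 (A : set V) x : open A -> A x -> (0 < leb A)%E.
Proof.
move=> oA Ax.
have /nbhs_ballP[e /= e0 eA] : nbhs x A by apply: open_nbhs_nbhs.
apply: (@lt_le_trans _ _ (leb (ball x e))).
  by rewrite lebesgue_vec_ball// lte_fin exprn_gt0// mulr_gt0.
by apply: le_measure => //; rewrite inE; [exact: measurable_vec_ball|exact: open_vec_measurable].
Qed.

Lemma lebesgue_vec_bounded_fin (A : set V) (r : R) : 0 < r -> measurable A ->
  (forall x, A x -> forall i, `|x i 0| < r) -> (leb A < +oo)%E.
Proof.
move=> r0 mA Ar.
apply: (@le_lt_trans _ _ (leb (ball (0:V) r))); last by rewrite lebesgue_vec_ball// ltry.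
apply: le_measure => //; rewrite ?inE //; first exact: measurable_vec_ball.
by move=> x /Ar h; apply/vec_ballP => // i; rewrite mxE sub0r normrN.
Qed.

Lemma lebesgue_vec_affine (p : V) (s : R) (A : set V) : 0 < s -> measurable A ->
  leb ((fun x => p + s *: x) @^-1` A) = ((s^-1 ^+ n)%:E * leb A)%E.
Proof.
move=> s0 mA; rewrite /lebesgue_vec /pushforward.
rewrite -(tuple_lebesgue_affine [tuple p i 0 | i < n])//.
congr (tuple_lebesgue n _); apply/funext => t /=; congr (A _).
by apply/colP => i; rewrite !mxE !tnth_mktuple.
Qed.

Lemma measurable_vec_affine (p : V) (s : R) :
  measurable_fun setT (fun x : V => p + s *: x).
Proof.
move=> _ B mB; rewrite setTI.
suff : measurable (tuple_affine [tuple p i 0 | i < n] s @^-1` (@vec_of_tuple R n @^-1` B)).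
  congr measurable; apply/funext => t /=; congr (B _).
  by apply/colP => i; rewrite !mxE !tnth_mktuple.
by rewrite -[X in measurable X]setTI; exact: measurable_tuple_affine.
Qed.

Lemma measurable_affine_form (c : R) (g : V) :
  measurable_fun setT (fun x : V => c + dot g x : measurableTypeR R).
Proof.
under eq_fun do rewrite dotE.
apply: measurable_funD => //; apply: measurable_sum => i.
by apply: measurable_funM => //; exact: measurable_coord.
Qed.
End VectorMeasure.

(** * Integrals of bounded functions and negligible sets *)

Section NullSets.
Context d (T : measurableType d) (R : realType) (mu : {measure set T -> \bar R}).
Import HBNNSimple.

(** No measurability is assumed: the partial derivatives of a hat function are
    under control only off the faces of the mesh. A simple function below f,
    set to zero on N, lies below g and keeps its integral. *)
Lemma ge0_le_integral_off_null (f g : T -> \bar R) (N : set T) :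
  measurable N -> mu N = 0%E ->
  (forall x, 0 <= f x)%E -> (forall x, 0 <= g x)%E ->
  (forall x, ~ N x -> f x = g x) ->
  (\int[mu]_x f x <= \int[mu]_x g x)%E.
Proof.
move=> mN N0 f0 g0 fg; rewrite !ge0_integralTE//.
apply: ge_ereal_sup => _ /= [h hf <-].
have mNC : measurable (~` N) by exact: measurableC.
apply: ereal_sup_ubound; exists (proj_nnsfun h mNC).
  move=> x; rewrite -mrestrict /patch; case: ifPn; rewrite ?inE => Nx.
    by rewrite -fg.
  exact: g0.
rewrite -mrestrict -integral_nnsfun// -setTD -ge0_negligible_integral ?integralT_nnsfun//.
- by apply/measurable_EFinP; exact: measurable_funP.
- by move=> x _; rewrite lee_fin.
Qed.

Lemma eq_integral_off_null (f g : T -> \bar R) (N : set T) :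
  measurable N -> mu N = 0%E -> (forall x, ~ N x -> f x = g x) ->
  (\int[mu]_x f x = \int[mu]_x g x)%E.
Proof.
move=> mN N0 fg; rewrite integralE [RHS]integralE; congr (_ - _)%E;
  apply/eqP; rewrite eq_le; apply/andP; split;
  apply: (ge0_le_integral_off_null mN N0) => // x Nx;
  by rewrite ?funeposE ?funenegE fg.
Qed.

(** Reduces an integral over the domain to integrals over the cells. As only
    the values of F on the pieces matter, F may be wild on N. *)
Lemma Rintegral_pieces (J : finType) (cs : {set J}) (D N : set T) (F : T -> R)
    (E : J -> set T) (G : J -> T -> R) :
  measurable N -> mu N = 0%E ->
  (forall S, S \in cs -> measurable (E S)) ->
  (forall S S' x, S \in cs -> S' \in cs -> E S x -> E S' x -> S = S') ->
  (forall S, S \in cs -> E S `<=` D) ->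
  (forall S, S \in cs -> mu.-integrable (E S) (EFin \o G S)) ->
  (forall S x, S \in cs -> E S x -> ~ N x -> F x = G S x) ->
  (forall x, D x -> ~ N x -> (forall S, S \in cs -> ~ E S x) -> F x = 0) ->
  Rintegral mu D F = \sum_(S in cs) Rintegral mu (E S) (G S).
Proof.
move=> mN N0 mE dE ED iG FG F0; rewrite Rintegral_mkcond.
have iGE S : S \in cs -> mu.-integrable setT (EFin \o (G S \_ (E S))).
  by move=> Scs; rewrite -restrict_EFin -integrable_mkcond//; [exact: iG|exact: mE].
transitivity (Rintegral mu setT (fun x => \sum_(S in cs) (G S \_ (E S)) x)).
  congr fine; apply: (eq_integral_off_null mN N0) => x Nx; congr EFin.
  have [[S [Scs ESx]]|nS] := pselect (exists S, S \in cs /\ E S x).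
    rewrite (bigD1 S)//= big1 ?addr0; last first.
      move=> S' /andP[S'cs S'S]; rewrite patchE memNset// => ES'x.
      by move/eqP: S'S; apply; exact: dE ES'x ESx.
    rewrite !patchE !mem_set//; last by apply: ED ESx.
    exact: FG.
  rewrite big1; last first.
    by move=> S Scs; rewrite patchE memNset// => ESx; apply: nS; exists S.
  rewrite patchE; case: ifPn => //; rewrite inE => Dx.
  by apply: F0 => // S Scs ESx; apply: nS; exists S.
pose H S x := if S \in cs then (G S \_ (E S)) x else 0.
have iH S : mu.-integrable setT (EFin \o H S).
  rewrite /H; have [Scs|_] := boolP (S \in cs); first exact: iGE.
  exact: integrable0.
rewrite /Rintegral.
transitivity (fine (\int[mu]_x (\sum_S (EFin \o H S) x))%E).
  by congr fine; apply: eq_integral => x _; rewrite big_mkcond/= -sumEFin.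
rewrite integral_sum// -sum_fine/=; last by move=> S _; apply: integrable_fin_num => //; exact: iH.
rewrite [RHS]big_mkcond; apply: eq_bigr => S _.
rewrite /H; case: ifP => Scs; last by rewrite integral0.
exact: esym (Rintegral_mkcond _ _ _).
Qed.
End NullSets.

Section BoundedMeasurable.
Context d (T : measurableType d) (R : realType) (mu : {measure set T -> \bar R}).
Implicit Types (E : set T) (f h : T -> R).

(** On a set of finite measure these functions are integrable, and they form an
    algebra; every integrand on a cell is of this kind. *)
Definition bmeas E f := measurable_fun E f /\ exists B, forall x, E x -> `|f x| <= B.

Lemma bmeas_cst E r : bmeas E (fun=> r).
Proof. by split => //; exists `|r|. Qed.

Lemma bmeasS E E' f : measurable E -> E' `<=` E -> bmeas E f -> bmeas E' f.
Proof.
move=> mE EE [mf [B fB]]; split; first exact: measurable_funS mf.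
by exists B => x /EE; exact: fB.
Qed.

Lemma bmeasD E f h : bmeas E f -> bmeas E h -> bmeas E (fun x => f x + h x).
Proof.
move=> [mf [B fB]] [mh [C hC]]; split; first exact: measurable_funD.
by exists (B + C) => x Ux; rewrite (le_trans (ler_normD _ _))// lerD ?fB ?hC.
Qed.

Lemma bmeasM E f h : bmeas E f -> bmeas E h -> bmeas E (fun x => f x * h x).
Proof.
move=> [mf [B fB]] [mh [C hC]]; split; first exact: measurable_funM.
by exists (B * C) => x Ux; rewrite normrM ler_pM ?fB ?hC.
Qed.

Lemma bmeas_sum E (J : Type) (s : seq J) (f : J -> T -> R) :
  (forall j, bmeas E (f j)) -> bmeas E (fun x => \sum_(j <- s) f j x).
Proof.
move=> hf; elim: s => [|j s IH].
  by under eq_fun do rewrite big_nil; exact: bmeas_cst.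
by under eq_fun do rewrite big_cons; exact: bmeasD.
Qed.

Variable E : set T.
Hypotheses (mE : measurable E) (Efin : (mu E < +oo)%E).

Lemma bmeas_integrable f : bmeas E f -> mu.-integrable E (EFin \o f).
Proof.
move=> [mf [B fB]]; apply: measurable_bounded_integrable => //.
exists B; split; first exact: num_real.
by move=> M BM x Ex /=; apply: le_trans (ltW BM); exact: fB.
Qed.

Lemma bmeas_RintegralD f h : bmeas E f -> bmeas E h ->
  Rintegral mu E (fun x => f x + h x) = Rintegral mu E f + Rintegral mu E h.
Proof. by move=> tf th; rewrite RintegralD//; exact: bmeas_integrable. Qed.

Lemma bmeas_RintegralZ r f : bmeas E f ->
  Rintegral mu E (fun x => r * f x) = r * Rintegral mu E f.
Proof. by move=> tf; rewrite RintegralZl//; exact: bmeas_integrable. Qed.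

Lemma bmeas_Rintegral_sum (J : Type) (s : seq J) (f : J -> T -> R) :
  (forall j, bmeas E (f j)) ->
  Rintegral mu E (fun x => \sum_(j <- s) f j x) = \sum_(j <- s) Rintegral mu E (f j).
Proof.
move=> hf; elim: s => [|j s IH].
  by under eq_Rintegral do rewrite big_nil; rewrite Rintegral_cst// mul0r big_nil.
under eq_Rintegral do rewrite big_cons.
by rewrite bmeas_RintegralD// ?big_cons ?IH//; exact: bmeas_sum.
Qed.

Lemma bmeas_le_Rintegral f h : bmeas E f -> bmeas E h -> (forall x, E x -> f x <= h x) ->
  Rintegral mu E f <= Rintegral mu E h.
Proof. by move=> tf th fh; apply: le_Rintegral => //; exact: bmeas_integrable. Qed.
End BoundedMeasurable.

(** * Measure and moments of a simplex *)

Section VectorMore.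
Context {R : realType} {n : nat}.
Local Notation V := ('cV[R]_n).
Local Notation leb := (@lebesgue_vec R n).

Lemma continuous_affine_form (c : R) (g : V) : continuous (fun x : V => c + dot g x).
Proof.
under eq_fun do rewrite dotE.
have H (s : seq 'I_n) : continuous (fun x : V => \sum_(i <- s) g i 0 * x i 0).
  elim: s => [|i s IH] x.
    by under eq_fun do rewrite big_nil; exact: cst_continuous.
  under eq_fun do rewrite big_cons.
  have Hi : {for x, continuous (fun x : V => g i 0 * x i 0)}.
    exact: continuousM (@cst_continuous _ _ (g i 0) x) (@coord_continuous R n 1 i 0 x).
  exact: continuousD Hi (IH x).
by move=> x; exact: continuousD (@cst_continuous _ _ c x) (H _ x).
Qed.

Lemma ge0_Rintegral_homothety (p : V) (s : R) (D : set V) (f : V -> R) : 0 < s ->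
  measurable D -> measurable_fun D f -> (forall x, D x -> 0 <= f x) ->
  Rintegral leb D f = s ^+ n * Rintegral leb ((fun x => p + s *: x) @^-1` D) (fun x => f (p + s *: x)).
Proof.
move=> s0 mD mf f0.
pose h x : V := p + s *: x.
have mh : measurable_fun setT h by exact: measurable_vec_affine.
have s0' : 0 <= s^-1 ^+ n by rewrite exprn_ge0// invr_ge0 ltW.
pose pf := measure_function_pushforward__canonical__measure_function_Measure leb mh.
have mfE : measurable_fun D (EFin \o f) by exact/measurable_EFinP.
have f0E x : D x -> (0 <= (EFin \o f) x)%E by move=> Dx; rewrite lee_fin f0.
have f0I : {in D, forall y, 0 <= (EFin \o f) y}%E by move=> y /[!inE]; exact: f0E.
have E := ge0_integral_pushforward mh leb mD mfE f0I.
rewrite {2}/Rintegral.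
transitivity (s ^+ n * fine (\int[pf]_(y in D) (EFin \o f) y)%E); last first.
  by congr (_ * fine _); exact: E.
have -> : (\int[pf]_(y in D) (EFin \o f) y = \int[mscale (NngNum s0') leb]_(y in D) (EFin \o f) y)%E.
  by apply: eq_measure_integral => B mB _; exact: lebesgue_vec_affine.
rewrite ge0_integral_mscale// /Rintegral.
have sn0 : 0 < s ^+ n by exact: exprn_gt0.
case: (\int[leb]_(x in D) (EFin \o f) x)%E => [r| |] /=.
- by rewrite mulrA exprVn divff ?mul1r// lt0r_neq0.
- by rewrite exprVn gt0_muley ?mulr0// lte_fin invr_gt0.
- by rewrite exprVn gt0_muleNy ?mulr0// lte_fin invr_gt0.
Qed.

End VectorMore.

Definition bary {R : realType} {n : nat} {I : Type} (c : I -> R) (g : I -> 'cV[R]_n)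
  (i : I) (x : 'cV[R]_n) : R := c i + dot (g i) x.

(** The affine functions [bary c g i] are the barycentric coordinates of the
    simplex with vertices [q i]. Their slopes [g i] are the gradients of the
    local hat functions. *)
Record barycentric {R : realType} {n : nat} {I : finType} (q : I -> 'cV[R]_n)
    (c : I -> R) (g : I -> 'cV[R]_n) : Prop := Barycentric {
  bary_sum : forall x, \sum_i bary c g i x = 1;
  bary_rec : forall x, \sum_i bary c g i x *: q i = x;
  bary_vert : forall i j, bary c g i (q j) = (i == j)%:R
}.

Section Cell.
Context {R : realType} {n : nat} {I : finType}.
Local Notation V := ('cV[R]_n).
Local Notation leb := (@lebesgue_vec R n).
Variables (q : I -> V) (c : I -> R) (g : I -> V).
Local Notation lam := (bary c g).
Hypothesis hq : barycentric q c g.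
Let lam_sum := bary_sum hq.
Let lam_rec := bary_rec hq.
Let lam_vert := bary_vert hq.
Hypothesis cardI : #|I| = n.+1.

Definition open_cell : set V := [set x | forall i, 0 < lam i x].
Definition closed_cell : set V := [set x | forall i, 0 <= lam i x].

(** The homothety of ratio s centred at vertex j maps the simplex onto its
    corner where coordinate j is at least 1 - s; this and the next lemmas make
    the self-similarity precise. *)
Lemma bary_homothety i j s x : lam i ((1 - s) *: q j + s *: x) = (1 - s) * (i == j)%:R + s * lam i x.
Proof.
rewrite -lam_vert /bary !dotE !mulrDr !mulr_sumr [in LHS](eq_bigr (fun k =>
  (1 - s) * (g i k 0 * q j k 0) + s * (g i k 0 * x k 0))); last first.
  by move=> k _; rewrite !mxE; ring.
by rewrite big_split/=; ring.
Qed.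

Lemma measurable_bary i : measurable_fun setT (lam i).
Proof. exact: measurable_affine_form. Qed.

Lemma open_cell_sub : open_cell `<=` closed_cell.
Proof. by move=> x h i; exact: ltW. Qed.

Lemma open_open_cell : open open_cell.
Proof.
rewrite openE => x h; rewrite /interior.
apply: (@filter_forall V I (fun i => [set y | 0 < lam i y]) (nbhs x)) => i.
have : nbhs (lam i x) [set y | 0 < y] by apply: open_nbhs_nbhs; split; [exact: open_gt|exact: h].
exact: continuous_affine_form.
Qed.

Lemma measurable_open_cell : measurable open_cell.
Proof. exact: open_vec_measurable open_open_cell. Qed.

Lemma measurable_bary_ge i s : measurable [set x | s <= lam i x].
Proof.
have := @measurable_bary i measurableT _ (measurable_itv `[s, +oo[).
rewrite setTI; congr measurable; apply/funext => x /=.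
by rewrite in_itv /= andbT.
Qed.

Lemma measurable_bary_gt i s : measurable [set x | s < lam i x].
Proof.
have := @measurable_bary i measurableT _ (measurable_itv `]s, +oo[).
rewrite setTI; congr measurable; apply/funext => x /=.
by rewrite in_itv /= andbT.
Qed.

Lemma measurable_closed_cell : measurable closed_cell.
Proof.
have -> : closed_cell = \bigcap_(i in [set: I]) [set x | 0 <= lam i x].
  by apply/seteqP; split => x h i //=; exact: h.
by apply: fin_bigcap_measurable => // i _; exact: measurable_bary_ge.
Qed.

Lemma open_cell_neq0 : open_cell (\sum_i n.+1%:R^-1 *: q i).
Proof.
move=> i; rewrite /bary dotE.
have -> : c i + \sum_k g i k 0 * (\sum_j n.+1%:R^-1 *: q j) k 0 = \sum_j n.+1%:R^-1 * lam i (q j).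
  rewrite /lam; under [RHS]eq_bigr do rewrite mulrDr dotE mulr_sumr.
  rewrite big_split/= sumr_const cardI exchange_big/=; congr (_ + _).
    rewrite -mulrnAl -mulr_natr mulVf ?mul1r// pnatr_eq0.
  by apply: eq_bigr => k _; rewrite summxE mulr_sumr; apply: eq_bigr => j _; rewrite mxE; ring.
rewrite (bigD1 i)//= lam_vert eqxx big1 ?addr0 ?mulr1 ?invr_gt0//.
by move=> j ji; rewrite lam_vert eq_sym (negbTE ji) mulr0.
Qed.

Lemma bary_le1 i x : closed_cell x -> lam i x <= 1.
Proof.
by move=> h; rewrite -(lam_sum x) (bigD1 i)//= lerDl sumr_ge0// => j _; exact: h.
Qed.

Lemma closed_cell_bounded x k : closed_cell x -> `|x k 0| < 1 + \sum_i \sum_k `|q i k 0|.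
Proof.
move=> h; rewrite -[x]lam_rec summxE (le_lt_trans (ler_norm_sum _ _ _))//.
rewrite -[ltLHS]add0r ltr_leD// ler_sum// => i _.
rewrite mxE normrM (ger0_norm (h i)) (le_trans (ler_piMl _ (bary_le1 i h)))//.
by rewrite (bigD1 k)//= lerDl sumr_ge0.
Qed.

Lemma closed_cell_fin : (leb closed_cell < +oo)%E.
Proof.
apply: (@lebesgue_vec_bounded_fin R n _ (1 + \sum_i \sum_k `|q i k 0|)) => [||x h k].
- by rewrite ltr_pwDl// sumr_ge0// => i _; rewrite sumr_ge0.
- exact: measurable_closed_cell.
- exact: closed_cell_bounded.
Qed.

Lemma sub_cell_fin A : measurable A -> A `<=` closed_cell -> leb A \is a fin_num.
Proof.
move=> mA Ac; rewrite ge0_fin_numE//; apply: le_lt_trans closed_cell_fin.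
by apply: le_measure => //; rewrite inE//; exact: measurable_closed_cell.
Qed.

Lemma closed_corner_preimage j s : 0 < s <= 1 ->
  (fun x => (1 - s) *: q j + s *: x) @^-1` (closed_cell `&` [set x | 1 - s <= lam j x]) = closed_cell.
Proof.
move=> /andP[s0 s1]; apply/seteqP; split => x /=.
  move=> [h hj] i; have := h i; rewrite bary_homothety.
  have [->|ij] := eqVneq i j.
    move: hj; rewrite bary_homothety eqxx mulr1 => hj _.
    by rewrite -(pmulr_rge0 _ s0); lra.
  by rewrite mulr0 add0r pmulr_rge0.
move=> h; split => [i|]; rewrite bary_homothety.
  by rewrite addr_ge0// mulr_ge0 ?subr_ge0 ?ler0n ?(ltW s0)//; exact: h.
have := mulr_ge0 (ltW s0) (h j); rewrite eqxx mulr1; lra.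
Qed.

Lemma open_corner_preimage j s : 0 < s <= 1 ->
  (fun x => (1 - s) *: q j + s *: x) @^-1` (open_cell `&` [set x | 1 - s < lam j x]) = open_cell.
Proof.
move=> /andP[s0 s1]; apply/seteqP; split => x /=.
  move=> [h hj] i; have := h i; rewrite bary_homothety.
  have [->|ij] := eqVneq i j.
    move: hj; rewrite bary_homothety eqxx mulr1 => hj _.
    by rewrite -(pmulr_rgt0 _ s0); lra.
  by rewrite mulr0 add0r pmulr_rgt0.
move=> h; split => [i|]; rewrite bary_homothety.
  have := mulr_gt0 s0 (h i); case: (i == j) => /=; lra.
have := mulr_gt0 s0 (h j); rewrite eqxx mulr1; lra.
Qed.

(** The face opposite to vertex j misses the corner of ratio s at j, whose
    measure is s ^ n times that of the simplex. Let s tend to 1. *)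
Lemma face_null j : leb (closed_cell `&` ~` [set x | 0 < lam j x]) = 0%E.
Proof.
set F := _ `&` _.
have mF : measurable F.
  by apply: measurableI; [exact: measurable_closed_cell|apply: measurableC; exact: measurable_bary_gt].
have mC := measurable_closed_cell.
have FC : F `<=` closed_cell by move=> x [].
have fF := sub_cell_fin mF FC; have fC := sub_cell_fin mC (@subset_refl _ _).
apply/eqP; rewrite eq_le measure_ge0 andbT -(fineK fF) lee_fin.
apply: (@le0_of_le_small _ _ (n%:R * fine (leb closed_cell))) => e /andP[e0 e1].
pose s := 1 - e.
have s01 : 0 < s <= 1 by rewrite /s; apply/andP; split; lra.
have /andP[s0 s1] := s01.
set K := closed_cell `&` [set x | 1 - s <= lam j x].
have mK : measurable K by apply: measurableI => //; exact: measurable_bary_ge.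
have fK : leb K \is a fin_num by apply: sub_cell_fin => // x [].
have E : leb closed_cell = ((s^-1 ^+ n)%:E * leb K)%E.
  by rewrite -(@lebesgue_vec_affine R n ((1 - s) *: q j))// closed_corner_preimage.
have E' : fine (leb K) = s ^+ n * fine (leb closed_cell).
  by rewrite E fineM//= exprVn mulrA divff ?mul1r// expf_neq0// lt0r_neq0.
have : (leb K + leb F <= leb closed_cell)%E.
  rewrite -measureU//; last first.
    rewrite -subset0 => x [[_ /= h1] [_ h2]]; apply: h2 => /=.
    by rewrite (lt_le_trans _ h1)// /s; lra.
  apply: le_measure; rewrite ?inE//; first exact: measurableU.
  by move=> x [[]|[]].
rewrite -(fineK fK) -(fineK fF) -(fineK fC) -EFinD lee_fin E'.
have v0 : 0 <= fine (leb closed_cell) by exact: fine_ge0.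
have := ler_wpM2r v0 (@bernoulli_le R n s _); rewrite (ltW s0) s1 => /(_ isT).
rewrite /s; lra.
Qed.

Lemma cell_boundary_negligible : leb.-negligible (closed_cell `\` open_cell).
Proof.
apply: (@negligibleS _ _ _ _ (\big[setU/set0]_(i : I) (closed_cell `&` ~` [set x | 0 < lam i x]))).
  move=> x [h /= /existsNP[i hi]]; rewrite -bigcup_seq.
  by exists i => //=; rewrite mem_index_enum.
apply: (big_ind (fun A => leb.-negligible A)).
- exact: negligible_set0.
- by move=> A B; exact: negligibleU.
- move=> i _; apply/negligibleP; last exact: face_null.
  by apply: measurableI; [exact: measurable_closed_cell|apply: measurableC; exact: measurable_bary_gt].
Qed.

Definition cell_volume := fine (leb open_cell).

Lemma open_cell_fin : leb open_cell \is a fin_num.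
Proof. exact: sub_cell_fin measurable_open_cell open_cell_sub. Qed.

Lemma cell_volume_gt0 : 0 < cell_volume.
Proof.
rewrite /cell_volume fine_gt0//; apply/andP; split.
  exact: (lebesgue_vec_open_gt0 open_open_cell open_cell_neq0).
by rewrite -ge0_fin_numE//; exact: open_cell_fin.
Qed.

Lemma open_cell_lty : (leb open_cell < +oo)%E.
Proof. by rewrite -ge0_fin_numE//; exact: open_cell_fin. Qed.

Lemma bmeas_bary i : bmeas open_cell (lam i).
Proof.
split; first exact: measurable_funS (measurable_bary i).
by exists 1 => x h; rewrite gtr0_norm//; apply: bary_le1; exact: open_cell_sub.
Qed.

Local Notation intU := (Rintegral leb open_cell).
Let mU := measurable_open_cell.
Let fU := open_cell_lty.

Lemma corner_integral (j : I) (s : R) (f : V -> R) : 0 < s <= 1 -> measurable_fun open_cell f ->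
  (forall x, open_cell x -> 0 <= f x) ->
  Rintegral leb (open_cell `&` [set x | 1 - s < lam j x]) f =
  s ^+ n * intU (fun x => f ((1 - s) *: q j + s *: x)).
Proof.
move=> s01 mf f0; have /andP[s0 _] := s01.
rewrite (@ge0_Rintegral_homothety R n ((1 - s) *: q j) s)//.
- by rewrite open_corner_preimage.
- by apply: measurableI => //; exact: measurable_bary_gt.
- by apply: measurable_funS mf => // x [].
- by move=> x [Ux _]; exact: f0.
Qed.

(** Let L be the integral and e = 1 - s. On the corner of ratio s at j the
    homothety gives s ^ n (e v + s L), and on the rest the coordinate is at
    most e, which contributes O(e ^ 2). So L (1 - s ^ (n + 1)) is e v up to
    O(e ^ 2), and dividing by e gives (n + 1) L = v in the limit. *)
Lemma first_moment j : n.+1%:R * intU (lam j) = cell_volume.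
Proof.
set L := intU _; set v := cell_volume.
have v0 : 0 < v := cell_volume_gt0.
have L0 : 0 <= L by apply: Rintegral_ge0 => x Ux; exact: ltW (Ux j).
have key e : 0 < e < 1 -> exists rho,
    L = (1 - e) ^+ n * (e * v + (1 - e) * L) + rho /\ 0 <= rho <= e * ((1 - (1 - e) ^+ n) * v).
  move=> /andP[e0 e1]; pose s := 1 - e.
  have s01 : 0 < s <= 1 by rewrite /s; apply/andP; split; lra.
  pose K := open_cell `&` [set x | 1 - s < lam j x].
  have mG : measurable [set x | 1 - s < lam j x] by exact: measurable_bary_gt.
  have mK : measurable K by exact: measurableI.
  have mUK : measurable (open_cell `\` K) by exact: measurableD.
  have UKU : K `|` (open_cell `\` K) = open_cell by apply: setDUK => x [].
  exists (Rintegral leb (open_cell `\` K) (lam j)); split.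
    rewrite {1}/L -[in LHS]UKU Rintegral_setU//; last 2 first.
    - by rewrite UKU; apply: bmeas_integrable => //; exact: bmeas_bary.
    - by apply/disj_setPS => x [? [_ ?]].
    rewrite corner_integral//; last by move=> x /(_ j)/ltW.
      congr (_ * _ + _).
      transitivity (intU (fun x => (1 - s) + s * lam j x)).
        by apply: eq_Rintegral => x _; have := bary_homothety j j s x; rewrite eqxx mulr1.
      rewrite bmeas_RintegralD ?Rintegral_cst ?bmeas_RintegralZ//; [|exact: bmeas_bary|exact: bmeas_cst|].
      + by rewrite /s; congr (_ * _ + _); lra.
      + by apply: bmeasM; [exact: bmeas_cst|exact: bmeas_bary].
    exact: measurable_funS (measurable_bary j).
  apply/andP; split; first by apply: Rintegral_ge0 => x [Ux _]; exact: ltW (Ux j).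
  have -> : (1 - (1 - e) ^+ n) * v = fine (leb (open_cell `\` K)).
    have fnU := open_cell_fin.
    have fK : leb K \is a fin_num by apply: sub_cell_fin => // x [Ux _]; exact: open_cell_sub.
    have fUK : leb (open_cell `\` K) \is a fin_num by apply: sub_cell_fin => // x [Ux _]; exact: open_cell_sub.
    have Ev : v = fine (leb K) + fine (leb (open_cell `\` K)).
      rewrite -fineD// -measureU//; first by rewrite UKU.
      by rewrite -subset0 => x [? [_ ?]].
    have := @corner_integral j s (fun=> 1) s01 (measurable_cst _) (fun _ _ => ler01).
    rewrite Rintegral_cst// mul1r Rintegral_cst// mul1r -/K -/cell_volume -/v -[1 - e]/s; lra.
  rewrite -Rintegral_cst//; apply: le_Rintegral => //.
  - apply: integrableS (bmeas_integrable mU fU (bmeas_bary j)) => //; exact: subDsetl.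
  - apply: integrableS (bmeas_integrable mU fU (bmeas_cst open_cell e)) => //; exact: subDsetl.
  - move=> x [Ux]; rewrite /K /= => /not_andP[//|/negP]; rewrite -leNgt => h.
    by apply: le_trans h _; rewrite /s; lra.
have bern (e : R) : 0 < e < 1 -> 1 - (1 - e) ^+ n <= n%:R * e.
  by move=> /andP[e0 e1]; have := @bernoulli_le R n (1 - e); rewrite opprB addrCA subrr addr0; apply; lra.
apply/eqP; rewrite eq_le; apply/andP; split; rewrite -subr_le0.
  apply: (@le0_of_le_small _ _ (n.+1%:R ^+ 2 * L)) => e e01.
  have [rho [EL /andP[rho0 rho1]]] := key e e01.
  have /andP[e0 e1] := e01.
  have b2 : n.+1%:R * e - (n.+1%:R * e) ^+ 2 <= 1 - (1 - e) ^+ n.+1 := bernoulli2_ge n.+1 e01.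
  have : L * (1 - (1 - e) ^+ n.+1) <= e * v by rewrite exprSr; nra.
  have := ler_wpM2l L0 b2 => h1 h2.
  rewrite -(ler_pM2r e0); lra.
apply: (@le0_of_le_small _ _ (n%:R * v)) => e e01.
have [rho [EL /andP[rho0 rho1]]] := key e e01.
have /andP[e0 e1] := e01.
have b1 := bern _ e01.
have b2 : 1 - (1 - e) ^+ n.+1 <= n.+1%:R * e.
  by have := @bernoulli_le R n.+1 (1 - e); rewrite opprB addrCA subrr addr0; apply; lra.
have : (1 - e) ^+ n * e * v <= L * (1 - (1 - e) ^+ n.+1) by rewrite exprSr; nra.
have := ler_wpM2l L0 b2 => h1 h2.
have := ler_wpM2r (mulr_ge0 (ltW e0) (ltW v0)) b1 => h3.
rewrite -(ler_pM2r e0); lra.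
Qed.
End Cell.

Section CellMass.
Context {R : realType} {n : nat} {I : finType}.
Local Notation V := ('cV[R]_n).
Local Notation leb := (@lebesgue_vec R n).
Variables (q : I -> V) (c : I -> R) (g : I -> V).
Local Notation lam := (bary c g).
Hypothesis hq : barycentric q c g.
Hypothesis cardI : #|I| = n.+1.
Local Notation U := (open_cell c g).
Local Notation intU := (Rintegral leb U).
Local Notation v := (cell_volume c g).
Let mU : measurable U. Proof. exact: measurable_open_cell. Qed.
Let fU : (leb U < +oo)%E. Proof. exact: open_cell_lty hq. Qed.

Definition cell_interp (a : I -> R) (x : V) : R := \sum_i lam i x * a i.

Lemma bmeas_interp a : bmeas U (cell_interp a).
Proof. by apply: bmeas_sum => i; apply: bmeasM; [exact: bmeas_bary hq i|exact: bmeas_cst]. Qed.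

Lemma intU_interp a : n.+1%:R * intU (cell_interp a) = v * \sum_i a i.
Proof.
rewrite /cell_interp (bmeas_Rintegral_sum mU fU); last first.
  by move=> i; apply: bmeasM; [exact: bmeas_bary hq i|exact: bmeas_cst].
rewrite !mulr_sumr; apply: eq_bigr => i _.
under eq_Rintegral do rewrite mulrC.
rewrite (bmeas_RintegralZ mU fU); last exact: bmeas_bary hq i.
by rewrite -(first_moment hq cardI i); ring.
Qed.

Lemma interp_homothety a j s x :
  cell_interp a ((1 - s) *: q j + s *: x) = (1 - s) * a j + s * cell_interp a x.
Proof.
rewrite /cell_interp (eq_bigr (fun i => (1 - s) * ((i == j)%:R * a i) + s * (lam i x * a i))); last first.
  by move=> i _; rewrite (bary_homothety hq); ring.
rewrite big_split/= -!mulr_sumr; congr (_ * _ + _).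
by rewrite (bigD1 j)//= eqxx mul1r big1 ?addr0// => i /negbTE ->; rewrite mul0r.
Qed.

(** Jensen's inequality: the coordinates are convex weights. *)
Lemma interp_sqr_le a x : U x -> cell_interp a x ^+ 2 <= cell_interp (fun i => a i ^+ 2) x.
Proof.
move=> Ux; set m := cell_interp a x.
have : 0 <= \sum_i lam i x * (a i - m) ^+ 2.
  by apply: sumr_ge0 => i _; rewrite mulr_ge0 ?sqr_ge0// ltW.
rewrite (eq_bigr (fun i => lam i x * a i ^+ 2 - (2 * m) * (lam i x * a i) + m ^+ 2 * lam i x)); last by move=> i _; ring.
rewrite !big_split/= sumrN -!mulr_sumr (bary_sum hq) -/(cell_interp a x) -/m -/(cell_interp (fun i => a i ^+ 2) x); lra.
Qed.

(** The corners of ratio 1/2 are disjoint, and on the corner at j the square of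
    the interpolant w has integral 2 ^ -n times that of ((a j + w) / 2) ^ 2. In
    the sum over j the cross terms add up to a nonnegative multiple of the
    squared sum of the a j, by the first moments, and the sum of the (a j) ^ 2
    remains. *)
Lemma second_moment_ge a : v * \sum_i a i ^+ 2 <= 2 ^+ n.+2 * intU (fun x => cell_interp a x ^+ 2).
Proof.
set w := cell_interp a; set Q := intU _.
have tw : bmeas U w by exact: bmeas_interp.
have tw2 : bmeas U (fun x => w x ^+ 2) by under eq_fun do rewrite expr2; exact: bmeasM.
have mw2 : measurable_fun U (fun x => w x ^+ 2) by case: tw2.
pose E (j : I) := U `&` [set x | 1 - 2^-1 < lam j x].
have mE j : measurable (E j) by apply: measurableI => //; exact: measurable_bary_gt.
have half : 0 < (2^-1 : R) <= 1 by rewrite invr_gt0 ltr0n invf_le1 ?ltr0n ?ler1n.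
have EQ : \sum_j Rintegral leb (E j) (fun x => w x ^+ 2) <= Q.
  pose D := \bigcup_j E j.
  have mD : measurable D by apply: fin_bigcup_measurable.
  have DU : D `<=` U by move=> x [j _ []].
  have -> : \sum_j Rintegral leb (E j) (fun x => w x ^+ 2) = Rintegral leb D (fun x => w x ^+ 2).
    rewrite (@Rintegral_pieces _ _ _ leb I [set: I]%SET D set0 _ E (fun _ x => w x ^+ 2)) ?measure0//.
    - by apply: eq_bigl => j; rewrite inE.
    - move=> i j x _ _ [Ux hi] [_ hj]; apply/eqP/negPn/negP => ij.
      have := bary_sum hq x; rewrite (bigD1 i)//= (bigD1 j)/=; last by rewrite eq_sym.
      have : 0 <= \sum_(k | (k != i) && (k != j)) lam k x by apply: sumr_ge0 => k _; exact: ltW (Ux k).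
      move: hi hj => /=; lra.
    - by move=> j _ x Ex; exists j.
    - by move=> j _; apply: integrableS (bmeas_integrable mU fU tw2) => // x [].
    - by move=> x [j _ Ex] _ /(_ j); rewrite inE => /(_ isT).
  rewrite /Q /Rintegral fine_le//.
  - apply: integrable_fin_num => //; exact: integrableS (bmeas_integrable mU fU tw2).
  - apply: integrable_fin_num => //; exact: bmeas_integrable.
  apply: ge0_subset_integral => //; first by apply/measurable_EFinP; exact: mw2.
  by move=> x _; rewrite lee_fin sqr_ge0.
have EE j : Rintegral leb (E j) (fun x => w x ^+ 2) =
   2^-1 ^+ n * (4^-1 * (a j ^+ 2 * v + 2 * a j * intU w + Q)).
  rewrite (corner_integral hq)//; last by move=> x _; exact: sqr_ge0.
  congr (_ * _).
  transitivity (intU (fun x => 4^-1 * (a j ^+ 2 + (2 * a j) * w x + w x ^+ 2))).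
    by apply: eq_Rintegral => x _; rewrite /w interp_homothety; field.
  have t1 : bmeas U (fun x => (2 * a j) * w x) by apply: bmeasM => //; exact: bmeas_cst.
  have t2 : bmeas U (fun x => a j ^+ 2 + (2 * a j) * w x) by apply: bmeasD => //; exact: bmeas_cst.
  rewrite (bmeas_RintegralZ mU fU); last exact: bmeasD.
  rewrite (bmeas_RintegralD mU fU)// (bmeas_RintegralD mU fU)//; last exact: bmeas_cst.
  by rewrite Rintegral_cst// (bmeas_RintegralZ mU fU).
have := EQ; rewrite (eq_bigr _ (fun j _ => EE j)) -!mulr_sumr !big_split/= -mulr_suml -mulr_suml -mulr_sumr sumr_const cardI.
have := intU_interp a; rewrite -/w => Ew.
have Q0 : 0 <= Q by apply: Rintegral_ge0 => x _; exact: sqr_ge0.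
have v0 : 0 < v := cell_volume_gt0 hq cardI.
(* the cross terms, up to the positive factor v / (n + 1) *)
have cross : 0 <= 2 * (\sum_i a i) * intU w.
  have := mulr_ge0 (ltW v0) (sqr_ge0 (\sum_i a i)).
  have : 0 < n.+1%:R :> R by rewrite ltr0n.
  move=> n0 h; rewrite -(pmulr_rge0 _ n0).
  have -> : n.+1%:R * (2 * (\sum_i a i) * intU w) = 2 * (\sum_i a i) * (n.+1%:R * intU w) by ring.
  rewrite Ew; lra.
move=> h.
have p0 : 0 < 2 ^+ n :> R by exact: exprn_gt0.
have e : 2 ^+ n * (2^-1 : R) ^+ n = 1 by rewrite -exprMn divff ?expr1n.
have := ler_wpM2l (ltW p0) h; rewrite [X in X <= _]mulrA e mul1r => h2.
have := mulrn_wge0 n.+1 Q0; rewrite !exprS; clear EE EQ h; move: cross h2; move: (intU w) (cell_volume c g) v0 Ew => X w0 _ _ cross h2; clearbody Q; lra.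
Qed.

(** The sharp constant is n + 2; the cruder 2 ^ (n + 2) / (n + 1) <= 8 leaves
    enough room in the descent estimate. *)
Lemma lumped_le_consistent a : n = 2%N \/ n = 3%N ->
  intU (cell_interp (fun i => a i ^+ 2)) <= 8 * intU (fun x => cell_interp a x ^+ 2).
Proof.
have := second_moment_ge a; have := intU_interp (fun i => a i ^+ 2) => <-.
have Q0 : 0 <= intU (fun x => cell_interp a x ^+ 2).
  by apply: Rintegral_ge0 => x _; exact: sqr_ge0.
move: (intU (fun x => cell_interp a x ^+ 2)) (intU (cell_interp (fun i => a i ^+ 2))) Q0 => B A B0.
by move=> h n23; move: h; case: n23 => ->; rewrite !exprS expr0; lra.
Qed.

Lemma consistent_le_lumped a :
  intU (fun x => cell_interp a x ^+ 2) <= intU (cell_interp (fun i => a i ^+ 2)).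
Proof.
apply: (bmeas_le_Rintegral mU fU); [|exact: bmeas_interp|by move=> x; exact: interp_sqr_le].
by under eq_fun do rewrite expr2; apply: bmeasM; exact: bmeas_interp.
Qed.
End CellMass.

(** * Barycentric coordinates on a triangulation *)

Section Simplex.
Context {R : realType} {n : nat}.
Local Notation V := ('cV[R]_n).

Lemma bary_combination (I : finType) (q : I -> V) c g (w : I -> R) i :
  barycentric q c g -> \sum_j w j = 1 -> bary c g i (\sum_j w j *: q j) = w i.
Proof.
move=> hq w1.
have -> : bary c g i (\sum_j w j *: q j) = \sum_j w j * bary c g i (q j).
  rewrite /bary; under [RHS]eq_bigr do rewrite mulrDr.
  rewrite big_split/= -mulr_suml w1 mul1r; congr (_ + _).
  rewrite dotE; under [RHS]eq_bigr do rewrite dotE mulr_sumr.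
  rewrite exchange_big/=; apply: eq_bigr => k _.
  by rewrite summxE mulr_sumr; apply: eq_bigr => j _; rewrite mxE; ring.
rewrite (bigD1 i)//= (bary_vert hq) eqxx mulr1 big1 ?addr0// => j ji.
by rewrite (bary_vert hq) eq_sym (negbTE ji) mulr0.
Qed.

Variables (m : nat) (vert : 'I_m -> V).

(** Affine independence says that the square matrix with rows (q k, 1) has
    trivial kernel. The columns of its inverse are the coefficients of the
    coordinates. *)
Lemma barycentric_exists (S : {set 'I_m}) : #|S| = n.+1 -> affinely_independent vert S ->
  exists cg : ('I_#|S| -> R) * ('I_#|S| -> V),
    barycentric (fun k : 'I_#|S| => vert (enum_val k)) cg.1 cg.2.
Proof.
move=> cS indep.
pose Q : 'M[R]_(#|S|, n) := \matrix_(k, l) vert (enum_val k) l 0.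
pose P : 'M[R]_(#|S|, n + 1) := row_mx Q (const_mx 1).
have freeP : row_free P.
  apply: inj_row_free => u uP.
  have [uQ u1] : u *m Q = 0 /\ u *m (const_mx 1 : 'cV_#|S|) = 0.
    by move: uP; rewrite /P mul_mx_row -row_mx0 => /eq_row_mx.
  pose w (i : 'I_m) := \sum_(k | enum_val k == i) u 0 k.
  have wk k : w (enum_val k) = u 0 k.
    by rewrite /w (big_pred1 k)// => l; rewrite (inj_eq enum_val_inj).
  have w0 i : i \notin S -> w i = 0.
    by move=> iS; rewrite /w big1// => k /eqP ki; move: iS; rewrite -ki enum_valP.
  have ws (F : 'I_m -> R) : \sum_i w i * F i = \sum_k u 0 k * F (enum_val k).
    rewrite [RHS](partition_big (fun k : 'I_#|S| => enum_val k) xpredT)//=.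
    by apply: eq_bigr => i _; rewrite /w mulr_suml; apply: eq_bigr => k /eqP <-.
  have wz : forall i, w i = 0.
    apply: indep => //.
      transitivity (\sum_i w i * 1); first by apply: eq_bigr => i _; rewrite mulr1.
      have := congr1 (fun M : 'M[R]_1 => M 0 0) u1; rewrite !mxE => h.
      by rewrite ws -[RHS]h; apply: eq_bigr => k _; rewrite mxE.
    apply/colP => l; rewrite summxE [RHS]mxE.
    under eq_bigr do rewrite mxE.
    have := congr1 (fun M : 'rV[R]_n => M 0 l) uQ; rewrite !mxE => h.
    by rewrite ws -[RHS]h; apply: eq_bigr => k _; rewrite mxE.
  by apply/rowP => k; rewrite -wk wz mxE.
(* freeness gives surjectivity because the matrix is square *)
have fullP : row_full P by rewrite /row_full (eqP freeP) cS addn1.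
have /row_fullP[B BP] := fullP.
pose X (x : V) : 'rV[R]_(n + 1) := row_mx x^T 1%:M.
pose c k := B (rshift n 0) k.
pose g k : V := \col_l B (lshift 1 l) k.
have baryE k x : bary c g k x = (X x *m B) 0 k.
  rewrite /bary mxE big_split_ord/= big_ord1 addrC dotE; congr (_ + _).
    by rewrite row_mxEr mxE mul1r; congr (B (rshift n _) k); apply/val_inj.
  by apply: eq_bigr => l _; rewrite row_mxEl !mxE mulrC.
have XBP x : X x *m B *m P = X x by rewrite -mulmxA BP mulmx1.
exists (c, g) => /=; split.
- move=> x; have := congr1 (fun M : 'rV_(n + 1) => M 0 (rshift n 0)) (XBP x).
  rewrite row_mxEr mxE => h; rewrite [RHS](_ : 1 = (1%:M : 'M[R]_1) 0 0); last by rewrite mxE.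
  by rewrite -h; apply: eq_bigr => k _; rewrite baryE /P row_mxEr [const_mx _ _ _]mxE mulr1.
- move=> x; apply/colP => l; have := congr1 (fun M : 'rV_(n + 1) => M 0 (lshift 1 l)) (XBP x).
  rewrite row_mxEl !mxE summxE => <-.
  by apply: eq_bigr => k _; rewrite mxE baryE /P row_mxEl [Q _ _]mxE.
- move=> i j; rewrite baryE.
  suff -> : X (vert (enum_val j)) *m B = delta_mx 0 j by rewrite mxE eqxx/= eq_sym.
  apply: (row_free_inj freeP) => /=; rewrite XBP -rowE.
  apply/rowP => l; rewrite !mxE; case: splitP => k _; rewrite !mxE//.
  by rewrite !ord1.
Qed.

Lemma simplex_closed_cell (S : {set 'I_m}) c g :
  barycentric (fun k : 'I_#|S| => vert (enum_val k)) c g ->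
  simplex vert S = closed_cell c g.
Proof.
move=> hq; apply/seteqP; split => x.
  move=> [w [w0 wS w1 ->]] k.
  have E (F : 'I_m -> V) : \sum_i w i *: F i = \sum_(k : 'I_#|S|) w (enum_val k) *: F (enum_val k).
    rewrite -(@big_enum_val _ _ _ _ _ (fun i => w i *: F i)) [RHS]big_mkcond/=.
    by apply: eq_bigr => i _; case: (boolP (i \in S)) => // iS; rewrite (wS i iS) scale0r.
  rewrite E (bary_combination k hq (w := fun k => w (enum_val k)))//.
  rewrite -(@big_enum_val _ _ _ _ _ w) -w1 big_mkcond/=.
  by apply: eq_bigr => i _; case: (boolP (i \in S)) => // iS; rewrite (wS i iS).
move=> h; exists (fun i => \sum_(k | enum_val k == i) bary c g k x); split.
- by move=> i; apply: sumr_ge0 => k _; exact: h.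
- by move=> i iS; rewrite big1// => k /eqP ki; move: iS; rewrite -ki enum_valP.
- by rewrite -(bary_sum hq x) [RHS](partition_big (fun k : 'I_#|S| => enum_val k) xpredT).
- rewrite -[LHS](bary_rec hq) (partition_big (fun k : 'I_#|S| => enum_val k) xpredT)//=.
  by apply: eq_bigr => i _; rewrite scaler_suml; apply: eq_bigr => k /eqP <-.
Qed.
End Simplex.

Section Cells.
Context {R : realType} {n : nat}.
Local Notation V := ('cV[R]_n).
Local Notation leb := (@lebesgue_vec R n).
Variable T : triangulation R n.
Local Notation m := (nverts T).

(** Stated for every vertex set so that the coordinates can be chosen once for
    all; nothing is claimed off the cells. *)
Lemma cell_coords_exist (S : {set 'I_m}) : exists cg : ('I_#|S| -> R) * ('I_#|S| -> V),
  S \in cells T -> barycentric (fun k : 'I_#|S| => vert (enum_val k)) cg.1 cg.2.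
Proof.
have [ST|_] := boolP (S \in cells T); last by exists (fun=> 0, fun=> 0).
have [cg h] := barycentric_exists (card_cell ST) (cell_nondegenerate ST).
by exists cg.
Qed.

Definition cell_coords (S : {set 'I_m}) := projT1 (cid (cell_coords_exist S)).
Definition cell_const S := (cell_coords S).1.
Definition cell_grad S := (cell_coords S).2.
Definition ocell S : set V := open_cell (@cell_const S) (@cell_grad S).

Lemma cell_barycentric S : S \in cells T ->
  barycentric (fun k : 'I_#|S| => vert (enum_val k)) (@cell_const S) (@cell_grad S).
Proof. by move: S => S; exact: (projT2 (cid (cell_coords_exist S))). Qed.

Lemma card_cell_ord S : S \in cells T -> #|'I_#|S| | = n.+1.
Proof. by move=> ST; rewrite card_ord card_cell. Qed.

Lemma cell_setE S : S \in cells T -> cell_set S = closed_cell (@cell_const S) (@cell_grad S).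
Proof. by move=> ST; exact: simplex_closed_cell (cell_barycentric ST). Qed.

Lemma ocell_sub S : S \in cells T -> ocell S `<=` cell_set S.
Proof. by move=> ST; rewrite cell_setE//; exact: open_cell_sub. Qed.

Lemma ocell_mesh S : S \in cells T -> ocell S `<=` mesh_domain T.
Proof.
move=> ST x Sx; rewrite /mesh_domain /interior.
have : nbhs x (ocell S) by apply: open_nbhs_nbhs; split => //; exact: open_open_cell.
by apply: filterS => y Sy; exists S => //; exact: ocell_sub.
Qed.

(** By conformity a common point lies in the common face, so its coordinate at
    a vertex of S outside S' vanishes. *)
Lemma ocell_disjoint S S' x : S \in cells T -> S' \in cells T ->
  ocell S x -> ocell S' x -> S = S'.
Proof.
move=> ST ST' Sx Sx'; apply/eqP; rewrite eqEcard (card_cell ST) (card_cell ST') leqnn andbT.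
apply/fintype.subsetP => i iS; apply/negPn/negP => iS'.
have : (simplex (@vert _ _ T) S `&` simplex (@vert _ _ T) S') x by split; exact: ocell_sub.
rewrite conforming// => -[w [w0 wI w1 xw]].
have wS j : j \notin S -> w j = 0 by move=> jS; apply: wI; rewrite inE (negbTE jS).
have := Sx (enum_rank_in iS i); rewrite xw.
have E (F : 'I_m -> V) : \sum_j w j *: F j = \sum_(k : 'I_#|S|) w (enum_val k) *: F (enum_val k).
  rewrite -(@big_enum_val _ _ _ _ _ (fun i => w i *: F i)) [RHS]big_mkcond/=.
  by apply: eq_bigr => j _; case: (boolP (j \in S)) => // jS; rewrite (wS j jS) scale0r.
rewrite E (bary_combination _ (cell_barycentric ST) (w := fun k => w (enum_val k))); last first.
  rewrite -(@big_enum_val _ _ _ _ _ w) -w1 big_mkcond/=.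
  by apply: eq_bigr => j _; case: (boolP (j \in S)) => // jS; rewrite (wS j jS).
by rewrite enum_rankK_in// wI ?ltxx// inE (negbTE iS') andbF.
Qed.

Lemma closed_mesh_compl_near x : ~ closed_mesh_domain T x ->
  \forall y \near x, ~ closed_mesh_domain T y.
Proof.
move=> nx.
have : \forall y \near x, forall S, S \in cells T -> ~ cell_set S y.
  apply: (@filter_forall V _ (fun S => [set y | S \in cells T -> ~ cell_set S y]) (nbhs x)) => S.
  have [ST|_] := boolP (S \in cells T); last by apply: nearW => y.
  have : ~ cell_set S x by move=> Sx; apply: nx; exists S.
  rewrite cell_setE// => /existsNP[k /negP]; rewrite -ltNge => hk.
  have : nbhs (bary (@cell_const S) (@cell_grad S) k x) [set y | y < 0].
    by apply: open_nbhs_nbhs; split; [exact: open_lt|exact: hk].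
  move=> /(@continuous_affine_form R n (cell_const k) (cell_grad k) x) H.
  apply: (@filterS _ (nbhs x) _ _ _ _ H) => y /= hy _ /(_ k); apply/negP; rewrite -ltNge.
  exact: hy.
by apply: (@filterS _ (nbhs x)) => y h [S ST]; exact: h.
Qed.

Lemma cells_boundary_negligible :
  leb.-negligible (\big[setU/set0]_(S in cells T) (cell_set S `\` ocell S)).
Proof.
apply: (big_ind (fun A => leb.-negligible A)).
- exact: negligible_set0.
- by move=> A B; exact: negligibleU.
- by move=> S ST; rewrite cell_setE//; exact: cell_boundary_negligible (cell_barycentric ST).
Qed.
End Cells.

(** * Mass matrix and lumped mass matrix *)

Section FiniteElements.
Context {R : realType} {n : nat}.
Local Notation V := ('cV[R]_n).
Local Notation leb := (@lebesgue_vec R n).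
Variables (Omega : set V) (T : triangulation R n) (N : nat).
Variables (node : 'I_N -> 'I_(nverts T)) (phi : 'I_N -> V -> R).
Hypothesis hphi : nodal_basis Omega node phi.
Hypothesis hmesh : mesh_domain T `<=` Omega.

Local Notation interp S := (cell_interp (@cell_const _ _ T S) (@cell_grad _ _ T S)).

(** Move a point of the cell slightly towards the barycentre. *)
Lemma cell_set_closure S : S \in cells T -> cell_set S `<=` closure Omega.
Proof.
move=> ST x; rewrite cell_setE// => Sx B Bx.
have hq := cell_barycentric ST.
have cI := card_cell_ord ST.
pose z : V := \sum_(k : 'I_#|S|) n.+1%:R^-1 *: vert (enum_val k).
have Sz : ocell S z by exact: open_cell_neq0 hq cI.
have H : {for (0 : R), continuous (fun t : R => t *: (z - x) + x)}.
  exact: (continuousD (@scalel_continuous _ _ (z - x) 0) (@cst_continuous _ _ x 0)).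
move: H; rewrite /prop_for /continuous_at scale0r add0r => /(_ B Bx) H.
have [e /= e0 eB] : exists2 e : R, 0 < e & forall t, 0 <= t < e -> B (t *: (z - x) + x).
  move/nbhs_ballP: H => [e /= e0 eB]; exists e => // t /andP[t0 te].
  by apply: eB; rewrite /ball/= sub0r normrN ger0_norm.
pose t := Num.min (e / 2) 1.
have t0 : 0 < t by rewrite lt_min divr_gt0//= ltr01.
have t1 : t <= 1 by rewrite ge_min lexx orbT.
have te : t < e by rewrite gt_min ltr_pdivrMr// mulr_natr mulr2n ltrDl e0.
exists (t *: (z - x) + x); split; last by apply: eB; rewrite ltW.
apply/hmesh/(ocell_mesh ST) => k.
have -> : t *: (z - x) + x = t *: z + (1 - t) *: x.
  by rewrite scalerBr scalerBl scale1r -addrA [- _ + x]addrC.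
have -> : bary (@cell_const _ _ T S) (@cell_grad _ _ T S) k (t *: z + (1 - t) *: x) =
  t * bary (@cell_const _ _ T S) (@cell_grad _ _ T S) k z + (1 - t) * bary (@cell_const _ _ T S) (@cell_grad _ _ T S) k x.
  rewrite /bary !dotE (eq_bigr (fun i => t * (cell_grad k i 0 * z i 0) + (1 - t) * (cell_grad k i 0 * x i 0))); last first.
    by move=> i _; rewrite !mxE; ring.
  by rewrite big_split/= -!mulr_sumr; ring.
have := mulr_gt0 t0 (Sz k); have := mulr_ge0 (eqbRL (subr_ge0 _ _) t1) (Sx k); lra.
Qed.

Lemma vert_in_cell (S : {set 'I_(nverts T)}) (v : 'I_(nverts T)) : v \in S -> cell_set S (@vert _ _ T v).
Proof.
move=> vS; exists (fun i => (i == v)%:R); split.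
- by move=> i; exact: ler0n.
- by move=> i iS; case: eqP => // iv; move: iS; rewrite iv vS.
- by rewrite (bigD1 v)//= eqxx big1 ?addr0// => i /negbTE ->.
- by rewrite (bigD1 v)//= eqxx scale1r big1 ?addr0// => i /negbTE ->; rewrite scale0r.
Qed.

(** A vertex that is not a node lies in the closure of Omega but outside the
    mesh domain, where the basis functions vanish. *)
Lemma phi_vert (v : 'I_(nverts T)) : (exists2 j, node j = v & forall i, phi i (vert v) = (i == j)%:R) \/
  (forall i, phi i (vert v) = 0).
Proof.
have [_ hnode hfe hd] := hphi.
have [/hnode[j jv]|nv] := pselect (mesh_domain T (vert v)).
  by left; exists j => // i; rewrite -jv hd.
right => i; have [_ _ h0] := hfe i; apply: h0; split => //.
by have [S ST vS] := vert_used v; apply: (cell_set_closure ST); exact: vert_in_cell.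
Qed.

Lemma phi_cell i S x : S \in cells T -> cell_set S x ->
  phi i x = interp S (fun k => phi i (vert (enum_val k))) x.
Proof.
move=> ST Sx; have [_ _ hfe _] := hphi.
have [_ /(_ S ST)[c [g cg]] _] := hfe i; have hq := cell_barycentric ST.
rewrite cg// /cell_interp.
under eq_bigr => k _ do rewrite (cg _ (vert_in_cell (enum_valP k))) mulrDr.
rewrite big_split/= -mulr_suml (bary_sum hq) mul1r; congr (_ + _).
rewrite -{1}[x](bary_rec hq) dotE; under [RHS]eq_bigr do rewrite dotE mulr_sumr.
rewrite exchange_big/=; apply: eq_bigr => l _; rewrite summxE mulr_sumr.
by apply: eq_bigr => k _; rewrite mxE; ring.
Qed.

Definition fe_fun (z : 'cV[R]_N) (x : V) : R := \sum_i z i 0 * phi i x.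

(** At a vertex at most one basis function is nonzero, and its value is 1. *)
Lemma fe_fun_sqr_vert (z : 'cV[R]_N) (v : 'I_(nverts T)) : \sum_i z i 0 ^+ 2 * phi i (vert v) = fe_fun z (vert v) ^+ 2.
Proof.
rewrite /fe_fun; have [[j _ h]|h] := phi_vert v.
  have E (w : 'I_N -> R) : \sum_i w i * phi i (vert v) = w j.
    rewrite (bigD1 j)//= h eqxx mulr1 big1 ?addr0// => i /negbTE ij.
    by rewrite h ij mulr0.
  by rewrite !E.
by rewrite !big1 ?expr0n// => i _; rewrite h mulr0.
Qed.

Definition cell_values (z : 'cV[R]_N) (S : {set 'I_(nverts T)}) (k : 'I_#|S|) : R :=
  fe_fun z (vert (enum_val k)).
Arguments cell_values z S k : clear implicits.

Lemma interp_sum (S : {set 'I_(nverts T)}) (I : finType) (w : I -> R) (a : I -> 'I_#|S| -> R) x :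
  \sum_i w i * interp S (a i) x = interp S (fun k => \sum_i w i * a i k) x.
Proof.
rewrite /cell_interp; under eq_bigr do rewrite mulr_sumr.
rewrite exchange_big/=; apply: eq_bigr => k _; rewrite mulr_sumr.
by apply: eq_bigr => i _; ring.
Qed.

Lemma fe_fun_cell z S x : S \in cells T -> cell_set S x ->
  fe_fun z x = interp S (cell_values z S) x.
Proof.
move=> ST Sx; rewrite /fe_fun; under eq_bigr do rewrite (phi_cell _ ST Sx).
by rewrite interp_sum.
Qed.

Lemma boundary_null_set : exists B : set V, [/\ measurable B, leb B = 0%E &
  forall S, S \in cells T -> cell_set S `\` ocell S `<=` B].
Proof.
have [B [mB B0 sB]] := cells_boundary_negligible T.
exists B; split => // S ST x Sx; apply: sB; rewrite -bigcup_seq_cond.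
by exists S => //=; rewrite mem_index_enum.
Qed.

Lemma mesh_integral (F : V -> R) (G : forall S : {set 'I_(nverts T)}, V -> R) :
  (forall S, S \in cells T -> bmeas (ocell S) (G S)) ->
  (forall S x, S \in cells T -> cell_set S x -> F x = G S x) ->
  Rintegral leb (mesh_domain T) F = \sum_(S in cells T) Rintegral leb (ocell S) (G S).
Proof.
move=> tG FG; have [B [mB B0 sB]] := boundary_null_set.
apply: (@Rintegral_pieces _ _ _ leb _ (cells T) _ B) => //.
- by move=> S ST; exact: measurable_open_cell.
- by move=> S S' x ST S'T; exact: ocell_disjoint.
- by move=> S ST; exact: ocell_mesh.
- move=> S ST; apply: bmeas_integrable (tG S ST); first exact: measurable_open_cell.
  exact: open_cell_lty (cell_barycentric ST).
- by move=> S x ST Sx _; apply: FG => //; exact: ocell_sub.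
- move=> x /interior_subset [S ST Sx] nB nS; exfalso; apply: nB; apply: (sB S) => //.
  by split => //; exact: nS.
Qed.

Lemma wnorm2_mass z : wnorm2 (mass_matrix T phi) z =
  \sum_(S in cells T) Rintegral leb (ocell S) (fun x => interp S (cell_values z S) x ^+ 2).
Proof.
pose P i S x := interp S (fun k => phi i (vert (enum_val k))) x.
have tP i S : S \in cells T -> bmeas (ocell S) (P i S).
  by move=> ST; exact: bmeas_interp (cell_barycentric ST) _.
rewrite wnorm2E.
transitivity (\sum_i \sum_j \sum_(S in cells T) (z i 0 * z j 0) * Rintegral leb (ocell S) (fun x => P i S x * P j S x)).
  apply: eq_bigr => i _; apply: eq_bigr => j _; rewrite mxE -mulr_sumr; congr (_ * _).
  apply: mesh_integral => [S ST|S x ST Sx]; first by apply: bmeasM; exact: tP.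
  by rewrite /P -!phi_cell.
under eq_bigr do rewrite exchange_big/=.
rewrite exchange_big/=; apply: eq_bigr => S ST.
have hq := cell_barycentric ST.
have mU : measurable (ocell S) by exact: measurable_open_cell.
have fU : (leb (ocell S) < +oo)%E := open_cell_lty hq.
have tt i j : bmeas (ocell S) (fun x => (z i 0 * z j 0) * (P i S x * P j S x)).
  by apply: bmeasM; [exact: bmeas_cst|apply: bmeasM; exact: tP].
transitivity (Rintegral leb (ocell S) (fun x => \sum_i \sum_j (z i 0 * z j 0) * (P i S x * P j S x))).
  rewrite (bmeas_Rintegral_sum mU fU); last by move=> i; apply: bmeas_sum => j; exact: tt.
  apply: eq_bigr => i _; rewrite (bmeas_Rintegral_sum mU fU)//.
  by apply: eq_bigr => j _; rewrite (bmeas_RintegralZ mU fU)//; apply: bmeasM; exact: tP.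
apply: eq_Rintegral => x _; rewrite -interp_sum expr2 mulr_suml; apply: eq_bigr => i _.
by rewrite mulr_sumr; apply: eq_bigr => j _; rewrite /P; ring.
Qed.

Lemma lumped_mass_offdiag i j : i != j -> lumped_mass_matrix T phi i j = 0.
Proof. by move=> ij; rewrite mxE (negbTE ij) mulr0n. Qed.

(** By [fe_fun_sqr_vert], weighting the basis functions by squares amounts to
    interpolating the squares of the vertex values. *)
Lemma wnorm2_lumped z : wnorm2 (lumped_mass_matrix T phi) z =
  \sum_(S in cells T) Rintegral leb (ocell S) (interp S (fun k => cell_values z S k ^+ 2)).
Proof.
pose P i S x := interp S (fun k => phi i (vert (enum_val k))) x.
have tP i S : S \in cells T -> bmeas (ocell S) (P i S).
  by move=> ST; exact: bmeas_interp (cell_barycentric ST) _.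
rewrite wnorm2E.
transitivity (\sum_i \sum_(S in cells T) (z i 0 ^+ 2) * Rintegral leb (ocell S) (P i S)).
  apply: eq_bigr => i _; rewrite (bigD1 i)//= big1 ?addr0; last first.
    by move=> j ji; rewrite lumped_mass_offdiag ?mulr0// eq_sym.
  rewrite -mulr_sumr -expr2 !mxE eqxx mulr1n; congr (_ * _).
  apply: mesh_integral => [S ST|S x ST Sx]; first exact: tP.
  by rewrite /P -!phi_cell.
rewrite exchange_big/=; apply: eq_bigr => S ST.
have hq := cell_barycentric ST.
have mU : measurable (ocell S) by exact: measurable_open_cell.
have fU : (leb (ocell S) < +oo)%E := open_cell_lty hq.
transitivity (Rintegral leb (ocell S) (fun x => \sum_i z i 0 ^+ 2 * P i S x)).
  rewrite (bmeas_Rintegral_sum mU fU); last by move=> i; apply: bmeasM; [exact: bmeas_cst|exact: tP].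
  by apply: eq_bigr => i _; rewrite (bmeas_RintegralZ mU fU)//; exact: tP.
apply: eq_Rintegral => x _; rewrite interp_sum /cell_interp; apply: eq_bigr => k _.
by rewrite fe_fun_sqr_vert.
Qed.

Lemma mass_le_lumped z :
  wnorm2 (mass_matrix T phi) z <= wnorm2 (lumped_mass_matrix T phi) z.
Proof.
rewrite wnorm2_mass wnorm2_lumped; apply: ler_sum => S ST.
exact: consistent_le_lumped (cell_barycentric ST) _.
Qed.

Lemma lumped_le_mass z : n = 2%N \/ n = 3%N ->
  wnorm2 (lumped_mass_matrix T phi) z <= 8 * wnorm2 (mass_matrix T phi) z.
Proof.
move=> n23; rewrite wnorm2_mass wnorm2_lumped mulr_sumr; apply: ler_sum => S ST.
exact: lumped_le_consistent (cell_barycentric ST) (card_cell_ord ST) _ n23.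
Qed.

Lemma mass_ge0 z : 0 <= wnorm2 (mass_matrix T phi) z.
Proof.
rewrite wnorm2_mass; apply: sumr_ge0 => S ST; apply: Rintegral_ge0 => x _.
exact: sqr_ge0.
Qed.

Lemma mass_sym : (mass_matrix T phi)^T = mass_matrix T phi.
Proof.
by apply/matrixP => i j; rewrite !mxE; apply: eq_Rintegral => x _; rewrite mulrC.
Qed.

Lemma fe_fun_node z i : fe_fun z (vert (node i)) = z i 0.
Proof.
have [_ _ _ hd] := hphi.
rewrite /fe_fun (bigD1 i)//= hd eqxx mulr1 big1 ?addr0// => j /negbTE ji.
by rewrite hd ji mulr0.
Qed.

Lemma mass_definite z : wnorm2 (mass_matrix T phi) z = 0 -> z = 0.
Proof.
rewrite wnorm2_mass => h; apply/colP => i; rewrite [RHS]mxE.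
have [S ST iS] := vert_used (node i).
have hq := cell_barycentric ST; have cI := card_cell_ord ST.
have : Rintegral leb (ocell S) (fun x => interp S (cell_values z S) x ^+ 2) = 0.
  have h0 S' : S' \in cells T -> 0 <= Rintegral leb (ocell S') (fun x => interp S' (cell_values z S') x ^+ 2).
    by move=> _; apply: Rintegral_ge0 => x _; exact: sqr_ge0.
  by have := psumr_eq0P h0 h; apply.
have := second_moment_ge hq cI (cell_values z S) => + E; rewrite E mulr0.
rewrite pmulr_rle0; last exact: cell_volume_gt0 hq cI.
rewrite (bigD1 (enum_rank_in iS (node i)))//= => le0.
have s0 : 0 <= \sum_(k | k != enum_rank_in iS (node i)) cell_values z S k ^+ 2.
  by apply: sumr_ge0 => k _; exact: sqr_ge0.
have := sqr_ge0 (cell_values z S (enum_rank_in iS (node i))) => s1.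
have /eqP : cell_values z S (enum_rank_in iS (node i)) ^+ 2 = 0 by lra.
by rewrite sqrf_eq0 /cell_values enum_rankK_in// fe_fun_node => /eqP.
Qed.

End FiniteElements.
Arguments cell_values {R n T N} phi z S k.

(** * Stiffness matrix *)

Section FiniteRange.
Context {R : realType}.

(** Otherwise all the values f a / (k + 1) are taken. *)
Lemma finite_range_IVT (f : R -> R) (a b : R) (s : seq R) : a <= b ->
  {within `[a, b], continuous f} -> (forall t, t \in `[a, b] -> f t \in s) -> f b = 0 -> f a = 0.
Proof.
move=> ab fc fs fb; apply/eqP/negPn/negP => fa0.
pose w (k : nat) : R := f a / k.+1%:R.
have wk k : w k \in s.
  have : Num.min (f a) (f b) <= w k <= Num.max (f a) (f b).
    rewrite fb /w; have k0 : 0 < k.+1%:R :> R by [].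
    have k1 : 1 <= k.+1%:R :> R by rewrite ler1n.
    rewrite ge_min le_max !ler_pdivlMr// !ler_pdivrMr// mul0r.
    have [fa|fa] := leP 0 (f a); apply/andP; split; apply/orP; [right|left|left|right] => //.
    + by rewrite ler_peMr.
    + by rewrite ler_neMr// ltW.
    + exact: ltW.
  by move/(IVT ab fc) => [t tab <-]; exact: fs.
have : (size [seq w k | k <- iota 0 (size s).+1] <= size s)%N.
  apply: uniq_leq_size; last by move=> x /mapP[k _ ->].
  rewrite map_inj_uniq ?iota_uniq// => k l /(mulfI fa0)/invr_inj/eqP.
  by rewrite eqr_nat eqSS => /eqP.
by rewrite size_map size_iota ltnn.
Qed.
End FiniteRange.

Section Ray.
Context {R : realType} {n : nat}.
Local Notation V := ('cV[R]_n).
Variable Omega : set V.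
Hypotheses (oO : open Omega) (bO : bounded_set Omega)
  (cO : convex_set (Omega : set (convex_lmodType V))).

(** The exit time is the supremum of the times spent in Omega: convexity gives
    the points before it, openness puts the exit point outside. *)
Lemma ray_exits (x : V) (i : 'I_n) : Omega x -> exists2 t : R, 0 <= t &
  [/\ closure Omega (t *: unit_vec i + x), ~ Omega (t *: unit_vec i + x) &
   forall s, 0 <= s < t -> Omega (s *: unit_vec i + x)].
Proof.
move=> Ox.
pose ray (t : R) : V := t *: unit_vec i + x.
have ray0 : ray 0 = x by rewrite /ray scale0r add0r.
have cray t : {for t, continuous ray}.
  exact: (continuousD (@scalel_continuous _ _ (unit_vec i : V) t) (@cst_continuous _ _ x t)).
pose T := [set t : R | 0 <= t /\ Omega (ray t)].
have T0 : T 0 by split => //; rewrite ray0.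
have [B hB] : exists B : R, forall y, Omega y -> `|y i 0| < B.
  have [M [_ hM]] := bO; exists (`|M| + 2) => y Oy.
  have M2 : 0 < `|M| + 2 by rewrite ltr_wpDl.
  have : ball (0 : V) (`|M| + 2) y.
    rewrite -ball_normE /ball_/= sub0r normrN.
    apply: (@le_lt_trans _ _ (`|M| + 1)); last by rewrite ltrD2l ltr1n.
    by apply: hM => //; rewrite (le_lt_trans (ler_norm M))// ltrDl.
  by move/(vec_ballP _ _ M2) => /(_ i); rewrite mxE sub0r normrN.
have supT : has_sup T.
  split; first by exists 0.
  exists (B + `|x i 0|) => t [t0 /hB]; rewrite /ray !mxE eqxx mulr1 => h.
  have := ler_norm (t + x i 0); have := ler_norm (- x i 0); rewrite normrN; lra.
have sT0 : 0 <= sup T by exact: ub_le_sup supT.2 _ T0.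
have h1 s : 0 <= s < sup T -> Omega (ray s).
  move=> /andP[s0 sT].
  have sT' : 0 < sup T - s by rewrite subr_gt0.
  have [t [t0 Ot]] := sup_adherent sT' supT; rewrite subKr => st.
  have tp : 0 < t by exact: le_lt_trans st.
  have l0 : 0 <= s / t by rewrite divr_ge0.
  have l1 : s / t <= 1 by rewrite ler_pdivrMr// mul1r ltW.
  have := cO (Itv01 l0 l1) (mem_set Ot) (mem_set Ox); rewrite inE.
  congr Omega; rewrite /conv/= /ray scalerDr scalerA divfK ?lt0r_neq0// -addrA -scalerDl.
  by rewrite unstable.add_onemK scale1r.
exists (sup T) => //; split => //.
- move=> W /(cray (sup T)) /nbhs_ballP[e /= e0 eW].
  have sTe : 0 < e / 2 by rewrite divr_gt0.
  have [t Tt te] := sup_adherent sTe supT.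
  have [t0 Ot] := Tt.
  exists (ray t); split => //; apply: eW; rewrite /ball/=.
  have := ub_le_sup supT.2 Tt => tT; rewrite ger0_norm ?subr_ge0//; lra.
- move=> Or.
  have : nbhs (ray (sup T)) Omega by exact: open_nbhs_nbhs.
  move=> /(cray (sup T)) /nbhs_ballP[e /= e0 eO].
  have : T (sup T + e / 2).
    split; first by rewrite addr_ge0// divr_ge0// ltW.
    apply: eO; rewrite /ball/= opprD addrA subrr sub0r normrN ger0_norm; lra.
  move=> /(ub_le_sup supT.2); rewrite gerDl; lra.
Qed.
End Ray.

Section Stiffness.
Context {R : realType} {n : nat}.
Local Notation V := ('cV[R]_n).
Local Notation leb := (@lebesgue_vec R n).
Variables (Omega : set V) (T : triangulation R n) (N : nat).
Variables (node : 'I_N -> 'I_(nverts T)) (phi : 'I_N -> V -> R).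
Hypothesis hphi : nodal_basis Omega node phi.
Hypothesis hmesh : mesh_domain T `<=` Omega.
Hypothesis oO : open Omega.
Variables (A : 'I_n -> 'I_n -> V -> R) (c0 : V -> R) (theta : R).
Hypothesis hA : elliptic_coefficients Omega A c0 theta.

Local Notation interp S := (cell_interp (@cell_const _ _ T S) (@cell_grad _ _ T S)).

Definition cell_slope (S : {set 'I_(nverts T)}) (a : 'I_#|S| -> R) : V :=
  \sum_k a k *: cell_grad k.

Lemma interp_affine (S : {set 'I_(nverts T)}) (a : 'I_#|S| -> R) x :
  interp S a x = \sum_k a k * cell_const k + dot (cell_slope a) x.
Proof.
rewrite /cell_interp /bary.
rewrite (eq_bigr (fun k => a k * cell_const k + a k * dot (cell_grad k) x)); last by move=> k _; ring.
rewrite big_split/=; congr (_ + _); rewrite dotE /cell_slope.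
under eq_bigr do rewrite dotE mulr_sumr.
rewrite exchange_big/=; apply: eq_bigr => l _; rewrite summxE mulr_suml.
by apply: eq_bigr => k _; rewrite mxE; ring.
Qed.

Let pv (i : 'I_N) (S : {set 'I_(nverts T)}) (k : 'I_#|S|) : R := phi i (vert (enum_val k)).

Lemma derive_phi_cell i l S x : S \in cells T -> ocell S x ->
  'D_(unit_vec l) (phi i) x = cell_slope (@pv i S) l 0.
Proof.
move=> ST Sx; apply: (@derive_affine_near _ _ _ _ _ (\sum_k pv i k * cell_const k) (cell_slope (@pv i S))).
have : nbhs x (ocell S) by apply: open_nbhs_nbhs; split => //; exact: open_open_cell.
apply: filterS => y Sy; apply: etrans (interp_affine _ _); apply: (phi_cell hphi) => //.
exact: ocell_sub.
Qed.

Lemma phi_off_mesh i x : Omega x -> ~ closed_mesh_domain T x ->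
  phi i x = 0 /\ forall l, 'D_(unit_vec l) (phi i) x = 0.
Proof.
move=> Ox nx.
have near0 : \forall y \near x, phi i y = 0.
  have hO : nbhs x Omega by exact: open_nbhs_nbhs.
  apply: filterS (filterI hO (closed_mesh_compl_near nx)) => y [Oy ny].
  have [_ _ hfe _] := hphi; have [_ _ h0] := hfe i; apply: h0; split.
    exact: subset_closure.
  by move=> /interior_subset.
split; first exact: nbhs_singleton near0.
move=> l; rewrite (@derive_affine_near _ _ _ _ l 0 0) ?mxE//.
apply: filterS near0 => y ->; rewrite dotE big1 ?addr0// => k _.
by rewrite mxE mul0r.
Qed.

(** One negligible set collects the boundaries of the cells and the points
    where some almost everywhere condition fails; off it these conditions can
    be used pointwise. *)
Lemma coefficients_off_null : exists Z : set V, [/\ measurable Z, leb Z = 0%E &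
  [/\ forall S, S \in cells T -> cell_set S `\` ocell S `<=` Z,
      forall i j, bmeas (Omega `\` Z) (A i j),
      bmeas (Omega `\` Z) c0 &
      forall x, Omega x -> ~ Z x -> 0 <= c0 x /\ forall xi : V,
        theta * enorm xi ^+ 2 <= \sum_i \sum_j A i j x * xi i 0 * xi j 0]].
Proof.
have [[hAB hc0] _ c0_ge0 _ hell] := hA.
have [mc0 [B0 hB0]] := hc0.
pose B i j := projT1 (cid (hAB i j).2).
have hB i j : {ae leb, forall x, Omega x -> `|A i j x| <= B i j}.
  exact: projT2 (cid (hAB i j).2).
have hBall : {ae leb, forall x, forall i j, Omega x -> `|A i j x| <= B i j}.
  apply: (@filter_forall V _ (fun i => [set x | forall j, Omega x -> `|A i j x| <= B i j])) => i.
  by apply: (@filter_forall V _ (fun j => [set x | Omega x -> `|A i j x| <= B i j])) => j; exact: hB.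
have [Z1 [mZ1 Z10 sZ1]] := filterI (filterI hBall hB0) (filterI c0_ge0 hell).
have [Z2 [mZ2 Z20 sZ2]] := boundary_null_set T.
have hgood x : ~ (Z1 `|` Z2) x -> ((forall i j, Omega x -> `|A i j x| <= B i j) /\ (Omega x -> `|c0 x| <= B0)) /\
   ((Omega x -> 0 <= c0 x) /\ (Omega x -> forall xi : V,
        theta * enorm xi ^+ 2 <= \sum_i \sum_j A i j x * xi i 0 * xi j 0)).
  by move=> nZ; apply: contrapT => h; apply: nZ; left; apply: sZ1 => -[[h1 h2] [h3 h4]]; exact: h.
have mO : measurable Omega by exact: open_vec_measurable.
exists (Z1 `|` Z2); split.
- exact: measurableU.
- apply/eqP; rewrite eq_le measure_ge0 andbT.
  apply: (@le_trans _ _ (leb Z1 + leb Z2)%E); first exact: measureU2.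
  by rewrite Z10 Z20 adde0.
split.
- by move=> S ST x Sx; right; exact: sZ2 Sx.
- move=> i j; split; first by apply: measurable_funS (hAB i j).1 => //; exact: subDsetl.
  by exists (B i j) => x [Ox /hgood [[h _] _]]; exact: h.
- split; first by apply: measurable_funS mc0 => //; exact: subDsetl.
  by exists B0 => x [Ox /hgood [[_ h] _]]; exact: h.
- by move=> x Ox /hgood [_ [h1 h2]]; split; [exact: h1|exact: h2].
Qed.

(** Off the negligible set the gradients of the basis functions are constant on
    each cell, so the quadratic form is a sum over the cells of integrals to
    which ellipticity applies pointwise. *)
Lemma stiffness_ge z : theta * \sum_(S in cells T) enorm (cell_slope (cell_values phi z S)) ^+ 2 * fine (leb (ocell S)) <=
  wnorm2 (stiffness_matrix Omega A c0 phi) z.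
Proof.
have [Z [mZ Z0 [sZ bA bc0 hell]]] := coefficients_off_null.
pose E (S : {set 'I_(nverts T)}) := ocell S `\` Z.
have mU (S : {set 'I_(nverts T)}) : measurable (ocell S) by exact: measurable_open_cell.
have mE (S : {set 'I_(nverts T)}) : measurable (E S) by exact: measurableD.
have EO S : S \in cells T -> E S `<=` Omega `\` Z.
  by move=> ST x [Sx nZ]; split => //; apply: hmesh; exact: (ocell_mesh ST).
have mO : measurable Omega by exact: open_vec_measurable.
have mOZ : measurable (Omega `\` Z) by exact: measurableD.
have vE (S : {set 'I_(nverts T)}) : leb (E S) = leb (ocell S).
  apply/eqP; rewrite eq_le; apply/andP; split.
    by apply: le_measure; rewrite ?inE//; exact: subDsetl.
  have -> : ocell S = E S `|` (ocell S `&` Z) by rewrite /E setUC setUIDK.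
  apply: (@le_trans _ _ (leb (E S) + leb (ocell S `&` Z))%E).
    by apply: measureU2 => //; exact: measurableI.
  rewrite [X in (_ + X)%E](_ : _ = 0%E) ?adde0//.
  by apply/eqP; rewrite eq_le measure_ge0 andbT -Z0; apply: le_measure; rewrite ?inE//; exact: measurableI.
have fE S : S \in cells T -> (leb (E S) < +oo)%E.
  by move=> ST; rewrite vE; exact: open_cell_lty (cell_barycentric ST).
pose P i S x := interp S (@pv i S) x.
pose D i S l := cell_slope (@pv i S) l 0.
have bP S a : S \in cells T -> bmeas (E S) (interp S a).
  move=> ST; apply: bmeasS (mU S) _ (bmeas_interp (cell_barycentric ST) a).
  exact: subDsetl.
pose G i j S x := \sum_k \sum_l A k l x * D i S k * D j S l + c0 x * P i S x * P j S x.
have bAE S k l : S \in cells T -> bmeas (E S) (A k l).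
  by move=> ST; apply: bmeasS (bA k l) => //; exact: EO.
have bcE S : S \in cells T -> bmeas (E S) c0.
  by move=> ST; apply: bmeasS bc0 => //; exact: EO.
have bG i j S : S \in cells T -> bmeas (E S) (G i j S).
  move=> ST; apply: bmeasD; last by apply: bmeasM; [apply: bmeasM; [exact: bcE|exact: bP]|exact: bP].
  apply: bmeas_sum => k; apply: bmeas_sum => l.
  by apply: bmeasM; [apply: bmeasM; [exact: bAE|exact: bmeas_cst]|exact: bmeas_cst].
have KE i j : stiffness_matrix Omega A c0 phi i j = \sum_(S in cells T) Rintegral leb (E S) (G i j S).
  rewrite mxE; apply: (@Rintegral_pieces _ _ _ leb _ (cells T) _ Z) => //.
  - by move=> S S' x ST ST' [Sx _] [Sx' _]; exact: ocell_disjoint Sx Sx'.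
  - by move=> S ST x /(EO S ST) [].
  - by move=> S ST; apply: bmeas_integrable => //; [exact: fE|exact: bG].
  - move=> S x ST [Sx nZ] _; rewrite /G; congr (_ + _ * _ * _).
    + apply: eq_bigr => k _; apply: eq_bigr => l _.
      by rewrite (derive_phi_cell _ _ ST Sx) (derive_phi_cell _ _ ST Sx).
    + by rewrite /P -(phi_cell hphi)//; exact: ocell_sub.
    + by rewrite /P -(phi_cell hphi)//; exact: ocell_sub.
  - move=> x Ox nZ nS.
    have nx : ~ closed_mesh_domain T x.
      move=> [S ST Sx]; apply: (nZ); apply: (sZ S ST); split => // Sx'.
      by apply: (nS S ST); split => // Zx; apply: nZ.
    have [p0 d0] := phi_off_mesh i Ox nx; have [q0 _] := phi_off_mesh j Ox nx.
    rewrite q0 mulr0 addr0 big1// => k _; rewrite big1// => l _.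
    by rewrite d0 mulr0 mul0r.
rewrite wnorm2E.
have -> : \sum_i \sum_j z i 0 * z j 0 * stiffness_matrix Omega A c0 phi i j =
   \sum_(S in cells T) Rintegral leb (E S) (fun x => \sum_i \sum_j (z i 0 * z j 0) * G i j S x).
  transitivity (\sum_i \sum_j \sum_(S in cells T) (z i 0 * z j 0) * Rintegral leb (E S) (G i j S)).
    by apply: eq_bigr => i _; apply: eq_bigr => j _; rewrite KE mulr_sumr.
  under eq_bigr do rewrite exchange_big/=.
  rewrite exchange_big/=; apply: eq_bigr => S ST.
  have fES := fE S ST.
  have tt i j : bmeas (E S) (fun x => (z i 0 * z j 0) * G i j S x).
    by apply: bmeasM; [exact: bmeas_cst|exact: bG].
  rewrite (bmeas_Rintegral_sum (mE S) fES); last by move=> i; apply: bmeas_sum => j; exact: tt.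
  apply: eq_bigr => i _; rewrite (bmeas_Rintegral_sum (mE S) fES)//.
  by apply: eq_bigr => j _; rewrite (bmeas_RintegralZ (mE S) fES)//; exact: bG.
rewrite mulr_sumr; apply: ler_sum => S ST.
set a := cell_values phi z S; set g := cell_slope a.
have gE l : g l 0 = \sum_i z i 0 * D i S l.
  rewrite /g /cell_slope summxE /D.
  under [RHS]eq_bigr do rewrite /cell_slope summxE mulr_sumr.
  rewrite exchange_big/=; apply: eq_bigr => k _; rewrite mxE /a /cell_values /fe_fun mulr_suml.
  by apply: eq_bigr => i _; rewrite mxE mulrA.
have GE x : \sum_i \sum_j (z i 0 * z j 0) * G i j S x =
   \sum_k \sum_l A k l x * g k 0 * g l 0 + c0 x * interp S a x ^+ 2.
  have -> : c0 x * interp S a x ^+ 2 = \sum_i \sum_j (z i 0 * z j 0) * (c0 x * P i S x * P j S x).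
    rewrite -(interp_sum (fun i => z i 0) (fun i => @pv i S)) expr2 mulr_suml mulr_sumr.
    apply: eq_bigr => i _; rewrite mulrA mulr_sumr; apply: eq_bigr => j _; rewrite /P /=; ring.
  have -> : \sum_k \sum_l A k l x * g k 0 * g l 0 =
    \sum_i \sum_j (z i 0 * z j 0) * (\sum_k \sum_l A k l x * D i S k * D j S l).
    transitivity (\sum_k \sum_l \sum_i \sum_j (z i 0 * z j 0) * (A k l x * D i S k * D j S l)).
      apply: eq_bigr => k _; apply: eq_bigr => l _; rewrite !gE -mulrA big_distrlr/= mulr_sumr.
      by apply: eq_bigr => i _; rewrite mulr_sumr; apply: eq_bigr => j _; ring.
    transitivity (\sum_i \sum_j \sum_k \sum_l (z i 0 * z j 0) * (A k l x * D i S k * D j S l)).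
      under eq_bigr do rewrite exchange_big/=.
      rewrite exchange_big/=; apply: eq_bigr => i _.
      under eq_bigr do rewrite exchange_big/=.
      by rewrite exchange_big/=.
    apply: eq_bigr => i _; apply: eq_bigr => j _; rewrite mulr_sumr.
    by apply: eq_bigr => k _; rewrite mulr_sumr.
  rewrite -big_split/=; apply: eq_bigr => i _; rewrite -big_split/=; apply: eq_bigr => j _.
  by rewrite /G mulrDr.
rewrite mulrA -vE -Rintegral_cst//.
apply: (bmeas_le_Rintegral (mE S) (fE S ST)); first exact: bmeas_cst.
  apply: bmeas_sum => i; apply: bmeas_sum => j.
  by apply: bmeasM; [exact: bmeas_cst|exact: bG].
move=> x Ex; rewrite GE; have [Ox nZ] := EO S ST x Ex.
have [c0x ell] := hell x Ox nZ.
by rewrite -[leLHS]addr0 lerD// mulr_ge0// sqr_ge0.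
Qed.

Hypothesis n_gt0 : (0 < n)%N.
Hypotheses (bO : bounded_set Omega)
  (cO : convex_set (Omega : set (convex_lmodType V))).

Lemma fe_fun_continuous z : {within closure Omega, continuous (fe_fun phi z)}.
Proof.
have [_ _ hfe _] := hphi.
apply/subspace_continuousP => x cx; rewrite /fe_fun.
have H (s : seq 'I_N) : (fun x : V => \sum_(i <- s) z i 0 * phi i x) @ within (closure Omega) (nbhs x) --> \sum_(i <- s) z i 0 * phi i x.
  elim: s => [|i s IH].
    by under eq_fun do rewrite big_nil; rewrite big_nil; exact: cvg_cst.
  under eq_fun do rewrite big_cons; rewrite big_cons.
  have [ci _ _] := hfe i.
  have := (subspace_continuousP _ _).1 ci x cx => ci'.
  by apply: cvgD IH; apply: cvgM ci'; exact: cvg_cst.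
exact: H.
Qed.

(** With zero slopes the function takes finitely many values. Along a ray from
    a node to the first exit point from Omega, where it vanishes, it is
    continuous, hence zero. *)
Lemma fe_fun_slope0 z : (forall S, S \in cells T -> cell_slope (cell_values phi z S) = 0) -> z = 0.
Proof.
move=> slope0; apply/colP => i; rewrite [RHS]mxE -(fe_fun_node hphi z i).
set x := vert (node i).
have [_ hnode hfe _] := hphi.
have mx : mesh_domain T x by apply/hnode; exists i.
have Ox := hmesh mx.
have [t t0 [ct nt ht]] := ray_exits oO bO cO (Ordinal n_gt0) Ox.
set e := unit_vec _ in ct nt ht.
pose ray (s : R) : V := s *: e + x.
pose vals := 0 :: [seq \sum_(k < #|C|) cell_values phi z C k * cell_const k | C : {set 'I_(nverts T)}].
have clray s : s \in `[0, t] -> closure Omega (ray s).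
  rewrite in_itv/= => /andP[s0]; rewrite le_eqVlt => /predU1P[->//|st].
  by apply: subset_closure; apply: ht; rewrite s0.
have hvals y : closure Omega y -> fe_fun phi z y \in vals.
  move=> cy; rewrite inE; apply/orP.
  have [my|nmy] := pselect (mesh_domain T y).
    right; have [S ST Sy] := interior_subset my.
    rewrite (fe_fun_cell hphi z ST Sy) interp_affine slope0//.
    rewrite (_ : dot 0 y = 0) ?addr0; last by rewrite dotE big1// => k _; rewrite mxE mul0r.
    by apply/fintype.imageP; exists S.
  left; apply/eqP; rewrite /fe_fun big1// => j _.
  by have [_ _ h0] := hfe j; rewrite h0 ?mulr0//.
have -> : x = ray 0 by rewrite /ray scale0r add0r.
apply: (finite_range_IVT (f := fun s => fe_fun phi z (ray s)) t0 _ (s := vals)).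
- apply/subspace_continuousP => s sI.
  have cray : {for s, continuous ray}.
    exact: (continuousD (@scalel_continuous _ _ e s) (@cst_continuous _ _ x s)).
  have := (subspace_continuousP _ _).1 (@fe_fun_continuous z) (ray s) (clray s sI).
  apply: cvg_comp => W; rewrite /within /= => hW.
  apply: (@filterS _ (nbhs s) _ _ _ _ (cray _ hW)) => s' /= h' s'I; apply: h'.
  exact: clray.
- by move=> s sI; apply: hvals; exact: clray.
- rewrite /fe_fun big1// => j _.
  have [_ _ h0] := hfe j; rewrite h0 ?mulr0//; split => // /hmesh; exact: nt.
Qed.

Lemma stiffness_unit : stiffness_matrix Omega A c0 phi \in unitmx.
Proof.
set K := stiffness_matrix _ _ _ _.
apply: trivial_kernel_unitmx => u Kz.
have [_ _ _ th0 _] := hA.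
have W0 : wnorm2 K u = 0.
  by rewrite /wnorm2 Kz dotE big1// => k _; rewrite [X in _ * X]mxE mulr0.
have := stiffness_ge u; rewrite -/K W0.
rewrite pmulr_rle0// => le0.
apply: fe_fun_slope0 => S ST.
have s0 S' : S' \in cells T -> 0 <= enorm (cell_slope (cell_values phi u S')) ^+ 2 * fine (leb (ocell S')).
  by move=> _; rewrite mulr_ge0 ?sqr_ge0 ?fine_ge0.
have : \sum_(S in cells T) enorm (cell_slope (cell_values phi u S)) ^+ 2 * fine (leb (ocell S)) = 0.
  by apply/eqP; rewrite eq_le le0 sumr_ge0.
move/(psumr_eq0P s0) => /(_ S ST)/eqP.
rewrite mulf_eq0 (gt_eqF (cell_volume_gt0 (cell_barycentric ST) (card_cell_ord ST))) orbF sqrf_eq0.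
rewrite /enorm sqrtr_eq0 dotE => h.
apply/colP => k; rewrite [RHS]mxE.
have h0 : \sum_k cell_slope (cell_values phi u S) k 0 * cell_slope (cell_values phi u S) k 0 = 0.
  by apply/eqP; rewrite eq_le h sumr_ge0// => l _; rewrite -expr2 sqr_ge0.
have : cell_slope (cell_values phi u S) k 0 * cell_slope (cell_values phi u S) k 0 = 0.
  by apply: (psumr_eq0P _ h0) => // l _; rewrite -expr2 sqr_ge0.
by move/eqP; rewrite mulf_eq0 orbb => /eqP.
Qed.

End Stiffness.

(** * Optimality conditions *)

Section OptimalityConditions.
Context {R : realType} {N : nat}.
Local Notation V := ('cV[R]_N).
Variables (K M W : 'M[R]_N) (alpha beta a b : R) (yc yd : V).
Hypotheses (Msym : M^T = M) (Wsym : W^T = W).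
Hypothesis Mge0 : forall x, 0 <= dot x (M *m x).
Hypothesis Wge0 : forall x, 0 <= dot x (W *m x).
Hypotheses (alpha_gt0 : 0 < alpha) (beta_gt0 : 0 < beta) (a_lt0 : a < 0) (b_gt0 : 0 < b).

Local Notation f := (f_obj K M alpha yc yd).
Local Notation g := (g_obj W alpha beta a b).

Lemma dotM x y : dot (M *m x) y = dot x (M *m y).
Proof. by rewrite dot_trmx Msym. Qed.
Lemma dotMC x y : dot x (M *m y) = dot y (M *m x).
Proof. by rewrite -dotM dotC. Qed.
Lemma dotW x y : dot (W *m x) y = dot x (W *m y).
Proof. by rewrite dot_trmx Wsym. Qed.
Lemma dotWC x y : dot x (W *m y) = dot y (W *m x).
Proof. by rewrite -dotW dotC. Qed.

(** [invmx K *m M] maps a control to the linear part of its state. *)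
Definition hess_f : 'M[R]_N := (invmx K *m M)^T *m M *m (invmx K *m M) + (alpha / 2) *: M.
Definition grad_f (u : V) : V :=
  (invmx K *m M)^T *m (M *m (state K M yc u - yd)) + (alpha / 2) *: (M *m u).

Lemma state_shift u v : state K M yc (u + v) = state K M yc u + (invmx K *m M) *m v.
Proof. by rewrite /state (addrAC u) !(mulmxDr M _ v) (mulmxDr (invmx K)) !mulmxA. Qed.

Lemma grad_f_shift u v : grad_f (u + v) = grad_f u + hess_f *m v.
Proof.
rewrite /grad_f /hess_f state_shift [_ + _ *m v - yd]addrAC.
move: (state K M yc u - yd) (invmx K *m M) => w S.
by rewrite !mulmxDr mulmxDl scalerDr -!scalemxAl -!mulmxA addrACA.
Qed.

Lemma f_taylor u v : f (u + v) = f u + dot (grad_f u) v + 2^-1 * dot v (hess_f *m v).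
Proof.
rewrite /f_obj state_shift [_ + _ *m v - yd]addrAC /wnorm2 /grad_f /hess_f.
move: (state K M yc u - yd) (invmx K *m M) => w S.
rewrite !mulmxDr mulmxDl !dot_lin -!mulmxA -!scalemxAl !dot_lin.
rewrite -(dot_trmx S v) (dot_trmx S^T) trmxK !dotM (dotMC (S *m v) w) (dotMC v u).
by field.
Qed.

Lemma gradientE u : gradient f u = grad_f u.
Proof.
apply/colP => i; rewrite mxE.
rewrite (@derive_quadratic_near _ _ _ _ _ (grad_f u i 0) (2^-1 * dot (unit_vec i) (hess_f *m unit_vec i)))//.
apply: (@nearW _ (nbhs (0 : R))) => h; rewrite [h *: _ + u]addrC f_taylor -scalemxAr !dotZr dotZl.
rewrite dot_unit; ring.
Qed.

Lemma hess_f_ge v : alpha / 2 * dot v (M *m v) <= dot v (hess_f *m v).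
Proof.
rewrite /hess_f; move: (invmx K *m M) => S.
by rewrite mulmxDl -scalemxAl !dot_lin lerDr -!mulmxA -(dot_trmx S).
Qed.

Lemma u_step (sigma : R) (delta lambda z u : V) :
  minimizer (u_objective K M alpha yc yd sigma delta lambda z) u ->
  grad_f u + M *m lambda + sigma *: (M *m (u - z)) = delta.
Proof.
move=> hmin; apply/eqP; rewrite -subr_eq0; apply/eqP; apply: dot_eq0.
set G := _ - delta.
apply: (@quadratic_min_linear0 _ _ (2^-1 * dot G (hess_f *m G) + sigma / 2 * dot G (M *m G))) => h.
have := hmin (u + h *: G); rewrite /u_objective f_taylor /wnorm2.
have EG : dot G G = dot (grad_f u) G + dot (M *m lambda) G + sigma * dot (u - z) (M *m G) - dot delta G.
  rewrite {1}/G; move: (grad_f u) (M *m lambda) (u - z) (G) => p q e G'.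
  by rewrite !dotDl dotNl dotZl dotM.
have -> : u + h *: G - z = (u - z) + h *: G by rewrite addrAC.
clearbody G.
move: EG; move: (grad_f u) (M *m lambda) (u - z) => p q e EG.
have -> : dot q (e + h *: G) = dot q e + h * dot q G by rewrite dotDr dotZr.
rewrite -subr_ge0 -scalemxAr !mulmxDr -!scalemxAr !dotDr !dotDl !dotZr !dotZl.
rewrite (dotMC G e) => hh.
apply: le_trans hh _; rewrite le_eqVlt; apply/orP; left; apply/eqP; rewrite EG; by field.
Qed.

Definition g_fin (z : V) : R := alpha / 4 * dot z (W *m z) + beta * l1norm (W *m z).

Lemma gE z : g z = if in_box a b z then (g_fin z)%:E else +oo%E.
Proof. by []. Qed.

Lemma in_box0 : in_box a b (0 : V).
Proof. by apply/forallP => i; rewrite mxE !ltW. Qed.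

Lemma in_box_segment (z w : V) t : 0 <= t <= 1 -> in_box a b z -> in_box a b w ->
  in_box a b (z + t *: (w - z)).
Proof.
move=> /andP[t0 t1] /forallP hz /forallP hw; apply/forallP => i; rewrite !mxE.
have /andP[z1 z2] := hz i; have /andP[w1 w2] := hw i.
apply/andP; split; nra.
Qed.

Lemma l1norm_segment (z w : V) t : 0 <= t <= 1 ->
  l1norm (z + t *: (w - z)) <= (1 - t) * l1norm z + t * l1norm w.
Proof.
move=> /andP[t0 t1]; rewrite /l1norm !mulr_sumr -big_split/= ler_sum// => i _.
rewrite !mxE (_ : z i 0 + t * (w i 0 - z i 0) = (1 - t) * z i 0 + t * w i 0); last by ring.
rewrite (le_trans (ler_normD _ _))// !normrM (ger0_norm t0) ger0_norm// subr_ge0//.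
Qed.

(** The quadratic part of g makes it strongly convex in the W-norm. *)
Lemma g_fin_segment z w t : 0 <= t <= 1 ->
  g_fin (z + t *: (w - z)) <= (1 - t) * g_fin z + t * g_fin w
    - t * (1 - t) * (alpha / 4 * dot (w - z) (W *m (w - z))).
Proof.
move=> t01; have := l1norm_segment (W *m z) (W *m w) t01.
rewrite /g_fin -mulmxBr scalemxAr -mulmxDr => /(ler_wpM2l (ltW beta_gt0)).
rewrite !mulmxDr -!scalemxAr !mulmxDr !mulmxN !dot_lin !(dotWC w z); nra.
Qed.

Lemma subdifferential_g z v : subdifferential g z v <->
  in_box a b z /\ forall w, in_box a b w -> g_fin z + dot v (w - z) <= g_fin w.
Proof.
rewrite /subdifferential /=; split.
  move=> h; have zb : in_box a b z.
    have := h 0; rewrite !gE in_box0; case: (in_box a b z) => //.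
  split=> // w wb; have := h w.
  by rewrite !gE zb wb -EFinD lee_fin.
move=> [zb h] w; rewrite !gE zb; case: ifPn => [wb|_]; last by rewrite leey.
by rewrite -EFinD lee_fin; exact: h.
Qed.

(** Compare along the segment from z to w and divide by its parameter, which
    tends to 0. *)
Lemma subgradient_strong z v w : subdifferential g z v -> in_box a b w ->
  g_fin z + dot v (w - z) + alpha / 4 * dot (w - z) (W *m (w - z)) <= g_fin w.
Proof.
move=> /subdifferential_g[zb h] wb.
rewrite -subr_ge0.
apply: (@right_derivative_ge0 _ _ (alpha / 4 * dot (w - z) (W *m (w - z)))) => t /andP[t0 t1].
have t01 : 0 <= t <= 1 by rewrite ltW.
have := h _ (in_box_segment t01 zb wb); have := g_fin_segment z w t01.
rewrite (addrC z) addrK dotZr; lra.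
Qed.

Lemma subgradient_monotone z v z' v' : subdifferential g z v -> subdifferential g z' v' ->
  alpha / 2 * dot (z - z') (W *m (z - z')) <= dot (v - v') (z - z').
Proof.
move=> hz hz'; have zb := ((subdifferential_g _ _).1 hz).1.
have zb' := ((subdifferential_g _ _).1 hz').1.
have := subgradient_strong hz zb'; have := subgradient_strong hz' zb.
have -> : z' - z = - (z - z') by rewrite opprB.
rewrite mulmxN !dot_lin; lra.
Qed.

(** Again by comparison along segments inside the box, where g is finite and
    convex. *)
Lemma z_step (sigma : R) (lambda u z : V) :
  minimizer (z_objective M W alpha beta a b sigma lambda u) z ->
  subdifferential g z (M *m lambda + sigma *: (W *m (u - z))).
Proof.
move=> hmin; apply/subdifferential_g.
have zb : in_box a b z.
  have := hmin 0; rewrite /z_objective !gE in_box0; case: (in_box a b z) => //.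
split=> // w wb; rewrite -subr_ge0.
apply: (@right_derivative_ge0 _ _ (sigma / 2 * dot (w - z) (W *m (w - z)))) => t /andP[t0 t1].
have t01 : 0 <= t <= 1 by rewrite ltW.
have := hmin (z + t *: (w - z)); rewrite /z_objective !gE zb (in_box_segment t01 zb wb).
rewrite -!EFinD lee_fin /wnorm2.
have -> : u - (z + t *: (w - z)) = (u - z) - t *: (w - z) by rewrite opprD addrA.
have := g_fin_segment z w t01.
have tt : 0 <= t * (1 - t) * (alpha / 4 * dot (w - z) (W *m (w - z))).
  by rewrite !mulr_ge0 ?subr_ge0 ?invr_ge0 ?(ltW t0) ?(ltW alpha_gt0).
move: (w - z) tt (u - z) => d tt e.
rewrite !mulmxDr !mulmxN -!scalemxAr !dot_lin (dotWC d e) (dotW e d); lra.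
Qed.

End OptimalityConditions.

(** * Summable sequences and the best residual *)

Section ScalarDescent.
Context {R : realType}.

(** The variables stand for scalar products: muu, mzu, ... in M and wuz, wzz,
    wuu in W, where u and z are the new errors, l the multiplier error, and e
    (z in mzu) the previous error of z. The three inequalities with lower bound
    0 for mixed terms are positivity of M at u - e and at u - z, and of W - M
    at z - u / 2; the last of them absorbs the mismatch between the norms of
    the two subproblems. *)
Lemma descent_arith (alpha sigma tau d muu mzu mlu mlz mzz mee mll mll' muz wuz wzz wuu : R) :
  0 < sigma -> sigma <= alpha / 4 -> 0 < tau -> tau <= 1 ->
  alpha / 2 * muu <= - mlu - sigma * (muu - mzu) + d ->
  alpha / 2 * wzz <= mlz + sigma * (wuz - wzz) ->
  mll' = mll + 2 * (tau * sigma) * (mlu - mlz) + (tau * sigma) ^+ 2 * (muu - 2 * muz + mzz) ->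
  0 <= muu - 2 * mzu + mee ->
  0 <= muu - 2 * muz + mzz ->
  0 <= (wzz - mzz) - (wuz - muz) + 4^-1 * (wuu - muu) ->
  wuu <= 8 * muu -> 0 <= muu -> 0 <= wzz ->
  mll' / (2 * (tau * sigma)) + sigma / 2 * mzz + (sigma / 4 * muu + 2 * sigma * wzz)
  <= mll / (2 * (tau * sigma)) + sigma / 2 * mee + d.
Proof.
move=> s0 sa t0 t1 hu hz hl p1 p2 p3 hw u0 w0.
have ts0 : 0 < tau * sigma by exact: mulr_gt0.
have -> : mll' / (2 * (tau * sigma)) = mll / (2 * (tau * sigma)) + (mlu - mlz) +
    tau * sigma / 2 * (muu - 2 * muz + mzz).
  by rewrite hl; field; rewrite !lt0r_neq0.
have q1 := mulr_ge0 (ltW s0) p1.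
have q2 : 0 <= (1 - tau) * (sigma * (muu - 2 * muz + mzz)).
  by rewrite !mulr_ge0 ?subr_ge0// ltW.
have q3 := mulr_ge0 (ltW s0) p3.
have q4 : 0 <= sigma * (8 * muu - wuu) by rewrite mulr_ge0 ?subr_ge0// ltW.
have q5 : 0 <= (alpha / 4 - sigma) * muu by rewrite mulr_ge0 ?subr_ge0.
have q6 : 0 <= (alpha / 4 - sigma) * wzz by rewrite mulr_ge0 ?subr_ge0.
lra.
Qed.
End ScalarDescent.

Section Series.
Context {R : realType}.
Implicit Types s : nat -> R.

Lemma summable_cvg0 s (B : R) : (forall k, 0 <= s k) -> (forall n, \sum_(0 <= k < n) s k <= B) ->
  s @ \oo --> (0 : R).
Proof.
move=> s0 sB; apply: cvg_series_cvg_0; apply: nondecreasing_is_cvgn.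
  by apply/nondecreasing_seqP => n; rewrite /series/= big_nat_recr//= lerDl.
by exists B => _ [n _ <-]; exact: sB.
Qed.

(** The sum of squares is at most the square of the sum. *)
Lemma summable_sqr (eps : nat -> R) : (forall k, 0 <= eps k) -> cvgn (series eps) ->
  exists E, forall n, \sum_(0 <= k < n) eps k ^+ 2 <= E.
Proof.
move=> e0 ecvg.
have nd : nondecreasing_seq (series eps).
  by apply/nondecreasing_seqP => n; rewrite /series/= big_nat_recr//= lerDl.
pose L := limn (series eps).
have hL n : series eps n <= L by exact: nondecreasing_cvgn_le.
exists (L ^+ 2) => n.
have H : \sum_(0 <= k < n) eps k ^+ 2 <= (\sum_(0 <= k < n) eps k) ^+ 2.
  elim: n => [|n IH]; first by rewrite !big_geq// expr0n.
  rewrite !big_nat_recr//= sqrrD.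
  have : 0 <= \sum_(0 <= k < n) eps k by apply: sumr_ge0 => i _; exact: e0.
  have := e0 n; move=> en sn; have := mulr_ge0 sn en; lra.
apply: le_trans H _.
have S0 : 0 <= \sum_(0 <= k < n) eps k by apply: sumr_ge0 => i _; exact: e0.
by rewrite ler_pXn2r ?nnegrE//; [exact: hL|exact: le_trans S0 (hL n)].
Qed.

Lemma best_residual_le (r : nat -> \bar R) k i : (0 < i <= k)%N -> (best_residual r k <= r i)%E.
Proof.
move=> /andP[i0 ik]; apply: (@le_trans _ _ (\big[Order.min/+oo%E]_(i <= j < i.+1) r j)).
  exact: le_bigmin_nat.
by rewrite big_ltn// ge_min lexx.
Qed.

Lemma best_residual_ge0 (r : nat -> \bar R) k : (forall i, 0 <= r i)%E -> (0 <= best_residual r k)%E.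
Proof. by move=> r0; apply: le_bigmin => // i _; exact: r0. Qed.

Lemma half_cvg_infty : (fun k : nat => k./2) @ \oo --> \oo.
Proof.
move=> A [M _ MA]; exists M.*2 => // k /= Mk; apply: MA => /=.
by rewrite -(doubleK M) half_leq.
Qed.

(** A minimum is at most the average over any block of indices: the first k
    indices give C / k, and those in (k/2, k] give k times the minimum at most
    twice a Cauchy difference of the partial sums. *)
Lemma best_residual_rate (r : nat -> \bar R) s (C : R) :
  (forall i, 0 <= r i)%E -> (forall i, r i.+1 <= (s i)%:E)%E ->
  (forall n, \sum_(0 <= k < n) s k <= C) ->
  (forall k, (1 <= k)%N -> (best_residual r k <= (C / k%:R)%:E)%E) /\
  ((fun k => (k%:R)%:E * best_residual r k)%E @ \oo --> (0%E : \bar R)).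
Proof.
move=> r0 rs sC.
have s0 i : 0 <= s i by rewrite -lee_fin (le_trans (r0 i.+1)).
have avg j k : (j < k)%N -> exists x : R, [/\ best_residual r k = x%:E, 0 <= x &
    (k - j)%:R * x <= \sum_(j <= i < k) s i].
  move=> jk; have b0 := best_residual_ge0 k r0.
  have bs i : (i < k)%N -> (best_residual r k <= (s i)%:E)%E.
    by move=> ik; apply: le_trans (rs i); apply: best_residual_le.
  have := bs j jk; case E: (best_residual r k) b0 => [x| |]// x0 _.
  exists x; split=> //; rewrite mulr_natl -(sumr_const_nat k j).
  by apply: ler_sum_nat => i /andP[_ ik]; have := bs i ik; rewrite E lee_fin.
split=> [k k0|].
  have [x [-> x0 hx]] := avg 0%N k k0.
  rewrite lee_fin ler_pdivlMr ?ltr0n// mulrC; apply: le_trans (sC k).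
  by move: hx; rewrite subn0.
have nd : nondecreasing_seq (series s).
  by apply/nondecreasing_seqP => n; rewrite /series/= big_nat_recr//= lerDl.
have scvg : series s @ \oo --> limn (series s).
  by apply: nondecreasing_is_cvgn => //; exists C => _ [n _ <-]; exact: sC.
pose t k := 2 * (series s k - series s k./2).
have tcvg : t @ \oo --> (0 : R).
  rewrite -[X in _ --> X](mulr0 2) -(subrr (limn (series s))).
  apply: cvgMl_tmp; apply: cvgB => //.
  exact: (cvg_comp _ _ half_cvg_infty scvg).
apply: (@squeeze_cvge _ _ _ _ (fun=> 0%E) _ (fun k => (t k)%:E)).
- apply: nearW => k; rewrite mule_ge0 ?lee_fin//=; last exact: best_residual_ge0.
  case: k => [|k]; first by rewrite mul0e lee_fin /t/= subrr mulr0.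
  have hk : (k.+1./2 < k.+1)%N by rewrite ltn_half_double -addnn addSn ltnS leq_addl.
  have [x [-> x0 hx]] := avg _ _ hk.
  rewrite -EFinM lee_fin /t (_ : series s k.+1 - _ = \sum_(k.+1./2 <= i < k.+1) s i); last first.
    by rewrite sub_series_geq// ltnW.
  apply: le_trans (ler_wpM2l _ hx) => //; rewrite mulrA ler_wpM2r// -natrM ler_nat.
  have hd : (k.+1./2.*2 <= k.+1)%N by rewrite -{2}(odd_double_half k.+1) leq_addl.
  rewrite mul2n doubleB leq_subRL; first by rewrite -(addnn k.+1) leq_add2r.
  by rewrite (leq_trans hd)// -(addnn k.+1) leq_addl.
- exact: cvg_cst.
- by apply: cvg_EFin => //; exact: nearW.
Qed.

End Series.

(** * Convergence of the inexact iteration *)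

Section Convergence.
Context {R : realType} {N : nat}.
Local Notation V := ('cV[R]_N).
Variables (K M W : 'M[R]_N) (alpha beta a b : R) (yc yd : V).
Hypotheses (Msym : M^T = M) (Wsym : W^T = W).
Hypothesis Mge0 : forall x, 0 <= dot x (M *m x).
Hypothesis Mdef : forall x, dot x (M *m x) = 0 -> x = 0.
Hypothesis MW : forall x, dot x (M *m x) <= dot x (W *m x).
Hypothesis WM : forall x, dot x (W *m x) <= 8 * dot x (M *m x).
Hypotheses (alpha_gt0 : 0 < alpha) (beta_gt0 : 0 < beta) (a_lt0 : a < 0) (b_gt0 : 0 < b).
Variables (sigma tau : R).
Hypotheses (sigma_gt0 : 0 < sigma) (sigma_le : sigma <= alpha / 4)
  (tau_gt0 : 0 < tau) (tau_le1 : tau <= 1).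

Local Notation g := (g_obj W alpha beta a b).
Local Notation grad_f := (grad_f K M alpha yc yd).
Local Notation hess_f := (hess_f K M alpha).
Local Notation m x := (dot x (M *m x)).

Let Wge0 x : 0 <= dot x (W *m x).
Proof. exact: le_trans (Mge0 x) (MW x). Qed.

Lemma M_unit : M \in unitmx.
Proof.
by apply: trivial_kernel_unitmx => x Mx0; apply: Mdef; rewrite Mx0 dotC /dot trmx0 mul0mx mxE.
Qed.

(** Expand the nonnegative square of [C *: x - invmx M *m x] in the M-norm,
    where C bounds the quadratic form of [invmx M]. *)
Lemma dot_le_M : exists2 k : R, 0 < k & forall x, dot x x <= k * m x.
Proof.
have [C C0 hC] := dot_mulmx_bounded (invmx M); exists C => // x.
have := Mge0 (C *: x - invmx M *m x).
rewrite mulmxBr -scalemxAr mulKVmx ?M_unit// !dot_lin -(dotM Msym (invmx M *m x) x) mulKVmx ?M_unit//.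
have := hC x; rewrite (dotC (invmx M *m x)) => h1 h2.
rewrite -(ler_pM2l C0); lra.
Qed.

Variables (us lambdas : V).
Hypothesis stat : grad_f us + M *m lambdas = 0.
Hypothesis subg : subdifferential g us (M *m lambdas).

(** Only the errors of the multiplier and of z enter: the new u is determined
    by them and by the perturbation. *)
Definition lyapunov (l z : V) : R := m l / (2 * (tau * sigma)) + sigma / 2 * m z.

Lemma grad_f_sub u : grad_f u = hess_f *m (u - us) - M *m lambdas.
Proof.
rewrite -{1}(subrK us u) addrC grad_f_shift -[in RHS]addrC; congr (_ + _).
by apply/eqP; rewrite -addr_eq0 stat.
Qed.

Lemma step_descent (delta l z u z' : V) :
  grad_f u + M *m l + sigma *: (M *m (u - z)) = delta ->
  subdifferential g z' (M *m l + sigma *: (W *m (u - z'))) ->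
  lyapunov (l + (tau * sigma) *: (u - z') - lambdas) (z' - us) +
    (sigma / 4 * m (u - us) + 2 * sigma * dot (z' - us) (W *m (z' - us))) <=
  lyapunov (l - lambdas) (z - us) + dot delta (u - us).
Proof.
move=> hu hz.
pose le := l - lambdas; pose ue := u - us; pose ze := z - us; pose zp := z' - us.
have Eu : hess_f *m ue = delta - M *m le - sigma *: (M *m (ue - ze)).
  have -> : ue - ze = u - z by rewrite /ue /ze opprB addrA subrK.
  rewrite -hu grad_f_sub /le (mulmxBr M l lambdas) -/ue.
  move: (hess_f *m ue) (M *m lambdas) (M *m l) (sigma *: _) => h s p q.
  by apply/colP => i; rewrite !mxE; ring.
have Ez : alpha / 2 * dot zp (W *m zp) <= dot (M *m le + sigma *: (W *m (ue - zp))) zp.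
  have -> : ue - zp = u - z' by rewrite /ue /zp opprB addrA subrK.
  rewrite /le (mulmxBr M l lambdas) addrAC.
  exact: (subgradient_monotone Wsym beta_gt0 a_lt0 b_gt0 hz subg).
have := hess_f_ge K alpha Mge0 ue; rewrite Eu.
have -> : l + (tau * sigma) *: (u - z') - lambdas = le + (tau * sigma) *: (ue - zp).
  by rewrite /ue /zp opprB addrA subrK /le addrAC.
move: Ez; rewrite -/ue -/zp -/ze -/le.
clearbody le ue ze zp => Ez Euu.
apply: (@descent_arith _ alpha sigma tau _ _ (dot ze (M *m ue)) (dot le (M *m ue))
  (dot le (M *m zp)) _ _ _ _ (dot ue (M *m zp)) (dot ue (W *m zp)) _ (dot ue (W *m ue))) => //.
- move: Euu; rewrite mulmxBr !dot_lin => /le_trans; apply.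
  rewrite (dotMC Msym ue le) (dotMC Msym ue ze) (dotC ue delta); lra.
- move: Ez => /le_trans; apply; rewrite mulmxBr !dot_lin (dotM Msym) (dotW Wsym ue) (dotW Wsym zp); lra.
- rewrite mulmxDr -scalemxAr mulmxBr !dot_lin (dotMC Msym ue le) (dotMC Msym zp le) (dotMC Msym zp ue); ring.
- have := Mge0 (ue - ze); rewrite mulmxBr !dot_lin (dotMC Msym ue ze); lra.
- have := Mge0 (ue - zp); rewrite mulmxBr !dot_lin (dotMC Msym zp ue); lra.
- have := MW (zp - 2^-1 *: ue); rewrite !mulmxBr -!scalemxAr !dot_lin (dotMC Msym zp ue) (dotWC Wsym zp ue); lra.
Qed.

(** Young's inequality in the M-norm, writing d as [M *m (invmx M *m d)]. *)
Lemma perturbation_bound : exists2 C : R, 0 <= C & forall d x : V,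
  dot d x <= sigma / 8 * m x + C * dot d d.
Proof.
have [C C0 hC] := dot_mulmx_bounded (invmx M).
exists (2 / sigma * C); first by rewrite !mulr_ge0 ?invr_ge0// ltW.
move=> d x; have := Mge0 (x - (4 / sigma) *: (invmx M *m d)).
rewrite mulmxBr -scalemxAr mulKVmx ?M_unit// !dot_lin -(dotM Msym (invmx M *m d) x) mulKVmx ?M_unit//.
rewrite (dotC x d) (dotC (invmx M *m d)).
have := hC d; set e := dot d (invmx M *m d); set dx := dot d x => hd h.
have : 0 <= sigma / 8 * (m x - 4 / sigma * dx - 4 / sigma * (dx - 4 / sigma * e)).
  by apply: mulr_ge0; [rewrite divr_ge0// ltW|move: (4 / sigma) h => t h; lra].
have -> : sigma / 8 * (m x - 4 / sigma * dx - 4 / sigma * (dx - 4 / sigma * e)) =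
  sigma / 8 * m x - dx + 2 / sigma * e by field; exact: lt0r_neq0.
have : 2 / sigma * e <= 2 / sigma * (C * dot d d) by rewrite ler_wpM2l// divr_ge0// ltW.
rewrite mulrA; lra.
Qed.

(** The equation of the u-step expresses M times the multiplier error by d and
    the errors of u and z. *)
Lemma multiplier_bound : exists2 C : R, 0 <= C & forall d u z l : V,
  grad_f u + M *m l + sigma *: (M *m (u - z)) = d ->
  dot (l - lambdas) (l - lambdas) <= C * (dot d d + m (u - us) + m (z - us)).
Proof.
have [k k0 hk] := dot_le_M.
have [C1 C10 h1] := mulmx_bounded (invmx M).
have [C2 C20 h2] := mulmx_bounded (- (invmx M *m (hess_f + sigma *: M))).
have [C3 C30 h3] := mulmx_bounded (sigma%:M : 'M[R]_N).
exists (3 * (C1 + C2 * k + C3 * k)).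
  by rewrite mulr_ge0// !addr_ge0// mulr_ge0// ltW.
move=> d u z l hd.
have -> : l - lambdas = invmx M *m d + (- (invmx M *m (hess_f + sigma *: M))) *m (u - us) + (sigma%:M : 'M[R]_N) *m (z - us).
  have uz : u - z = (u - us) - (z - us) by rewrite opprB addrA subrK.
  have e1 h e : invmx M *m (h - M *m lambdas + M *m l + sigma *: (M *m e)) =
      invmx M *m h - lambdas + l + sigma *: e.
    by rewrite !mulmxDr mulmxN -scalemxAr !mulKmx ?M_unit.
  have e2 e : - (invmx M *m (hess_f + sigma *: M)) *m e = - (invmx M *m (hess_f *m e) + sigma *: e).
    by rewrite mulNmx mulmxDr mulmxDl -scalemxAr mulVmx ?M_unit// -scalemxAl mul1mx mulmxA.
  rewrite -hd grad_f_sub e1 e2 mul_scalar_mx uz.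
  move: (invmx M *m (hess_f *m (u - us))) (u - us) (z - us) => h p q.
  by apply/colP => i; rewrite !mxE; ring.
apply: le_trans (dot_sum3 _ _ _) _.
have := h1 d; have := h2 (u - us); have := h3 (z - us).
have := hk (u - us); have := hk (z - us).
move=> /(ler_wpM2l C30) e1 /(ler_wpM2l C20) e2 f3 f2 f1.
have := dot_ge0 d; have := Mge0 (u - us); have := Mge0 (z - us).
move: (m (u - us)) (m (z - us)) (dot d d) e1 e2 f3 f2 f1 => mu mz dd e1 e2 f3 f2 f1 z0 u0 d0.
have := mulr_ge0 C10 u0; have := mulr_ge0 C10 z0.
have := mulr_ge0 (mulr_ge0 C20 (ltW k0)) d0; have := mulr_ge0 (mulr_ge0 C20 (ltW k0)) z0.
have := mulr_ge0 (mulr_ge0 C30 (ltW k0)) d0; have := mulr_ge0 (mulr_ge0 C30 (ltW k0)) u0.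
lra.
Qed.

Lemma dist0_ge0 (S : set V) : (0 <= dist0 S)%E.
Proof. by apply: le_ereal_inf_tmp => _ [v _ <-]; rewrite lee_fin sqrtr_ge0. Qed.

Lemma dist0_sqr_le (S : set V) v : S v -> (dist0 S ^+ 2 <= (dot v v)%:E)%E.
Proof.
move=> Sv; rewrite -enorm_sqr EFin_expe !expe2.
have h : (dist0 S <= (enorm v)%:E)%E by apply: ereal_inf_lbound; exists v.
by apply: lee_pmul => //; exact: dist0_ge0.
Qed.

Lemma KKT_residual_ge0 u z l : (0 <= KKT_residual K M W alpha beta a b yc yd u z l)%E.
Proof.
rewrite /KKT_residual !adde_ge0 ?lee_fin ?sqr_ge0// expe2.
by rewrite mule_ge0// dist0_ge0.
Qed.

(** The z-step provides an element of the subdifferential whose distance to [M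
    *m l] is a linear function of u - z. *)
Lemma residual_bound : exists2 C : R, 0 <= C & forall l0 u z l : V,
  l = l0 + (tau * sigma) *: (u - z) ->
  subdifferential g z (M *m l0 + sigma *: (W *m (u - z))) ->
  (KKT_residual K M W alpha beta a b yc yd u z l <=
   (C * (m (u - us) + m (z - us) + dot (l - lambdas) (l - lambdas)))%:E)%E.
Proof.
have [k k0 hk] := dot_le_M.
have [C1 C10 h1] := mulmx_bounded M.
have [C2 C20 h2] := mulmx_bounded hess_f.
have [C3 C30 h3] := mulmx_bounded (sigma *: W - (tau * sigma) *: M).
exists (2 * (C1 + C2 * k + (C3 + 1) * (2 * k))).
  by rewrite !(mulr_ge0, addr_ge0)// ltW.
move=> l0 u z l hl hz.
set S := [set - (M *m l) + v | v in subdifferential g z].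
have hS : S ((sigma *: W - (tau * sigma) *: M) *m (u - z)).
  exists (M *m l0 + sigma *: (W *m (u - z))) => //.
  rewrite hl (mulmxDr M) -scalemxAr mulmxBl -!scalemxAl.
  move: (M *m l0) (M *m (u - z)) (W *m (u - z)) => p q s.
  by apply/colP => i; rewrite !mxE; ring.
have -> : KKT_residual K M W alpha beta a b yc yd u z l =
  ((enorm (M *m l + grad_f u) ^+ 2)%:E + dist0 S ^+ 2 + (enorm (u - z) ^+ 2)%:E)%E.
  by rewrite /KKT_residual (gradientE K alpha yc yd Msym).
apply: (@le_trans _ _ ((dot (M *m l + grad_f u) (M *m l + grad_f u))%:E +
   (dot ((sigma *: W - (tau * sigma) *: M) *m (u - z)) ((sigma *: W - (tau * sigma) *: M) *m (u - z)))%:E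
   + (dot (u - z) (u - z))%:E)%E).
  by rewrite !enorm_sqr; do !apply: leeD => //; exact: dist0_sqr_le.
rewrite -!EFinD lee_fin.
have -> : M *m l + grad_f u = M *m (l - lambdas) + hess_f *m (u - us).
  by rewrite grad_f_sub (mulmxBr M l lambdas) addrCA addrC.
have uz : dot (u - z) (u - z) <= (2 * k) * (m (u - us) + m (z - us)).
  have -> : u - z = (u - us) + - (z - us) by rewrite opprB addrA subrK.
  apply: le_trans (dot_sum2 _ _) _; rewrite dotNl dotNr opprK.
  have := hk (u - us); have := hk (z - us); lra.
have e1 := h1 (l - lambdas).
have e2 := le_trans (h2 (u - us)) (ler_wpM2l C20 (hk (u - us))).
have e3 := le_trans (h3 (u - z)) (ler_wpM2l C30 uz).
have e4 := dot_sum2 (M *m (l - lambdas)) (hess_f *m (u - us)).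
have := Mge0 (u - us); have := Mge0 (z - us); have := dot_ge0 (l - lambdas).
move: (m (u - us)) (m (z - us)) (dot (l - lambdas) (l - lambdas)) uz e1 e2 e3 e4 => mu mz ll uz e1 e2 e3 e4 l00 z00 u00.
have := mulr_ge0 C10 u00; have := mulr_ge0 C10 z00.
have := mulr_ge0 (mulr_ge0 C20 (ltW k0)) l00; have := mulr_ge0 (mulr_ge0 C20 (ltW k0)) z00.
have := mulr_ge0 (mulr_ge0 C30 (ltW k0)) l00; have := mulr_ge0 (ltW k0) l00.
have := mulr_ge0 (mulr_ge0 C30 (ltW k0)) u00; have := mulr_ge0 (ltW k0) u00.
have := mulr_ge0 (mulr_ge0 C30 (ltW k0)) z00; have := mulr_ge0 (ltW k0) z00.
lra.
Qed.
End Convergence.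

Section EnormLimit.
Context {R : realType} {N : nat}.

(** The bound starts at index 1 because the initial u is arbitrary. *)
Lemma enorm_cvg0 (x : nat -> 'cV[R]_N) (t : nat -> R) (C : R) :
  (forall k, dot (x k.+1) (x k.+1) <= C * t k) -> t @ \oo --> (0 : R) ->
  (fun k => enorm (x k)) @ \oo --> (0 : R).
Proof.
move=> xt tcvg; rewrite -cvg_shiftS /=.
have Ct : (fun k => C * t k) @ \oo --> (0 : R).
  by rewrite -[X in _ --> X](mulr0 C); exact: cvgMl_tmp.
have dcvg : (fun k => dot (x k.+1) (x k.+1)) @ \oo --> (0 : R).
  apply: (@squeeze_cvgr _ _ _ _ (fun=> 0) (fun k => C * t k)) => //; last exact: cvg_cst.
  by apply: nearW => k; rewrite dot_ge0 xt.
have := cvg_comp _ _ dcvg (@sqrt_continuous R 0).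
by rewrite sqrtr0.
Qed.

Lemma enorm_mulmx_cvg0 (B : 'M[R]_N) (x : nat -> 'cV[R]_N) :
  (fun k => enorm (x k)) @ \oo --> (0 : R) -> (fun k => enorm (B *m x k)) @ \oo --> (0 : R).
Proof.
move=> xcvg; have [C C0 hC] := mulmx_bounded B.
have d0 : (fun k => dot (x k.+1) (x k.+1)) @ \oo --> (0 : R).
  have H : (fun k => enorm (x k.+1)) @ \oo --> (0 : R).
    by rewrite (cvg_shiftS (fun k => enorm (x k))).
  rewrite (_ : (fun k => _) = (fun k => enorm (x k.+1) * enorm (x k.+1))); last first.
    by apply/funext => k; rewrite -expr2 enorm_sqr.
  by have h := cvgM H H; rewrite mulr0 in h; exact: h.
by apply: (enorm_cvg0 _ d0) => k; exact: hC.
Qed.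
End EnormLimit.

Section ADMM.
Context {R : realType} {N : nat}.
Local Notation V := ('cV[R]_N).
Variables (K M W : 'M[R]_N) (alpha beta a b : R) (yc yd : V).
Hypotheses (Msym : M^T = M) (Wsym : W^T = W).
Hypothesis Mge0 : forall x, 0 <= dot x (M *m x).
Hypothesis Mdef : forall x, dot x (M *m x) = 0 -> x = 0.
Hypothesis MW : forall x, dot x (M *m x) <= dot x (W *m x).
Hypothesis WM : forall x, dot x (W *m x) <= 8 * dot x (M *m x).
Hypotheses (alpha_gt0 : 0 < alpha) (beta_gt0 : 0 < beta) (a_lt0 : a < 0) (b_gt0 : 0 < b).
Variables (sigma tau : R).
Hypotheses (sigma_gt0 : 0 < sigma) (sigma_le : sigma <= alpha / 4)
  (tau_gt0 : 0 < tau) (tau_le1 : tau <= 1).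
Variable eps : nat -> R.
Hypotheses (eps_ge0 : forall k, 0 <= eps k) (eps_cvg : cvgn (series eps)).
Variables (us lambdas : V).
Hypothesis stat : grad_f K M alpha yc yd us + M *m lambdas = 0.
Hypothesis subg : subdifferential (g_obj W alpha beta a b) us (M *m lambdas).
Local Notation m x := (dot x (M *m x)).

Let Wge0 x : 0 <= dot x (W *m x).
Proof. exact: le_trans (Mge0 x) (MW x). Qed.

Lemma admm_summable (z0 lambda0 : V) : exists B : R, forall delta u z lambda : nat -> V,
  z 0%N = z0 -> lambda 0%N = lambda0 ->
  ihADMM K M W alpha beta a b yc yd sigma tau eps delta u z lambda ->
  forall n, \sum_(0 <= k < n) (m (u k.+1 - us) + m (z k.+1 - us)) <= B.
Proof.
have [E hE] := summable_sqr eps_ge0 eps_cvg.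
have [C C0 hC] := perturbation_bound Msym Mge0 Mdef sigma_gt0.
exists (8 / sigma * (lyapunov M sigma tau (lambda0 - lambdas) (z0 - us) + C * E)).
move=> delta u z lambda hz0 hl0 [_ hstep] n.
pose v k := lyapunov M sigma tau (lambda k - lambdas) (z k - us).
pose s k := m (u k.+1 - us) + m (z k.+1 - us).
have step k : v k.+1 + sigma / 8 * s k <= v k + C * eps k ^+ 2.
  have [hd /(u_step Msym) hu /(z_step Wsym Wge0 alpha_gt0 beta_gt0 a_lt0 b_gt0) hz hl] := hstep k.
  have := step_descent Msym Wsym Mge0 MW WM beta_gt0 a_lt0 b_gt0 sigma_gt0 sigma_le tau_gt0 tau_le1 stat subg hu hz.
  rewrite -hl -/(v k) -/(v k.+1).
  have := hC (delta k) (u k.+1 - us).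
  have dd : C * dot (delta k) (delta k) <= C * eps k ^+ 2.
    by rewrite ler_wpM2l// -enorm_sqr ler_pXn2r ?nnegrE// sqrtr_ge0.
  have := mulr_ge0 (ltW sigma_gt0) (Mge0 (z k.+1 - us)).
  have := ler_wpM2l (ltW sigma_gt0) (MW (z k.+1 - us)).
  rewrite /s; lra.
have total : v n + sigma / 8 * \sum_(0 <= k < n) s k <= v 0%N + C * \sum_(0 <= k < n) eps k ^+ 2.
  elim: n => [|n IH]; first by rewrite !big_geq// !mulr0.
  by rewrite !big_nat_recr//=; have := step n; lra.
have v0 : 0 <= v n.
  rewrite /v /lyapunov addr_ge0// mulr_ge0 ?Mge0 ?invr_ge0 ?mulr_ge0//; try exact: ltW.
rewrite -hz0 -hl0 -/(v 0%N) -(@ler_pM2l _ (sigma / 8)) ?divr_gt0//.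
rewrite [leRHS](_ : _ = v 0%N + C * E); last by field; exact: lt0r_neq0.
have := ler_wpM2l C0 (hE n); lra.
Qed.

Theorem admm_convergence (z0 lambda0 : V) : exists C : R,
  forall delta u z lambda : nat -> V,
  z 0%N = z0 -> lambda 0%N = lambda0 ->
  ihADMM K M W alpha beta a b yc yd sigma tau eps delta u z lambda ->
  let r := fun k => KKT_residual K M W alpha beta a b yc yd (u k) (z k) (lambda k) in
  [/\ (fun k => enorm (u k - us)) @ \oo --> (0 : R),
      (fun k => enorm (z k - us)) @ \oo --> (0 : R),
      (fun k => enorm (lambda k - lambdas)) @ \oo --> (0 : R),
      forall k, (1 <= k)%N -> (best_residual r k <= (C / k%:R)%:E)%E &
      (fun k => (k%:R)%:E * best_residual r k)%E @ \oo --> (0%E : \bar R)].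
Proof.
have [E hE] := summable_sqr eps_ge0 eps_cvg.
have [B hB] := admm_summable z0 lambda0.
have [k k0 hk] := dot_le_M Msym Mge0 Mdef.
have [Cl Cl0 hCl] := multiplier_bound Msym Mge0 Mdef sigma stat.
have [Cr Cr0 hCr] := residual_bound W beta a b Msym Mge0 Mdef sigma tau stat.
exists (Cr * (B + Cl * (E + B + B))).
move=> delta u z lambda hz0 hl0 hADMM r.
have := hB delta u z lambda hz0 hl0 hADMM.
set s := fun k => m (u k.+1 - us) + m (z k.+1 - us) => sB.
have [_ hstep] := hADMM.
have s0 j : 0 <= s j by rewrite addr_ge0.
have s_cvg : s @ \oo --> (0 : R) by exact: summable_cvg0 s0 sB.
have eps2_cvg : (fun j => eps j ^+ 2) @ \oo --> (0 : R).
  by apply: summable_cvg0 hE => j; exact: sqr_ge0.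
have hl j : dot (lambda j.+1 - lambdas) (lambda j.+1 - lambdas) <= Cl * (eps j.+1 ^+ 2 + s j.+1 + s j).
  have [hd /(u_step Msym) hu _ _] := hstep j.+1.
  apply: le_trans (hCl _ _ _ _ hu) _; rewrite ler_wpM2l//.
  have dd : dot (delta j.+1) (delta j.+1) <= eps j.+1 ^+ 2.
    by rewrite -enorm_sqr ler_pXn2r ?nnegrE// sqrtr_ge0.
  have := Mge0 (z j.+2 - us); have := Mge0 (u j.+1 - us); rewrite /s; lra.
(* lambda j.+1 is read off the u-step that starts from it, which brings in eps
   and s at the index j.+1 *)
pose rho j := Cr * (s j + Cl * (eps j.+1 ^+ 2 + s j.+1 + s j)).
have r_rho j : (r j.+1 <= (rho j)%:E)%E.
  have [_ _ /(z_step Wsym Wge0 alpha_gt0 beta_gt0 a_lt0 b_gt0) hz hlj] := hstep j.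
  apply: le_trans (hCr _ _ _ _ hlj hz) _.
  by rewrite lee_fin /rho ler_wpM2l// lerD.
have rho_sum n : \sum_(0 <= j < n) rho j <= Cr * (B + Cl * (E + B + B)).
  have split4 (t1 t2 t3 t4 : nat -> R) :
      \sum_(0 <= j < n) Cr * (t1 j + Cl * (t2 j + t3 j + t4 j)) =
      Cr * (\sum_(0 <= j < n) t1 j + Cl * (\sum_(0 <= j < n) t2 j +
        \sum_(0 <= j < n) t3 j + \sum_(0 <= j < n) t4 j)).
    by rewrite -mulr_sumr big_split/= -mulr_sumr !big_split.
  rewrite /rho split4; apply: ler_wpM2l => //.
  have shift (t : nat -> R) (T : R) : (forall j, 0 <= t j) -> (forall p, \sum_(0 <= j < p) t j <= T) ->
      \sum_(0 <= j < n) t j.+1 <= T.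
    move=> t0 tT; apply: le_trans (tT n.+1); rewrite [leRHS]big_nat_recl//= lerDr//.
  apply: lerD; first exact: sB.
  apply: ler_wpM2l => //; apply: lerD; last exact: sB.
  apply: lerD; last exact: shift.
  by apply: (shift (fun j => eps j ^+ 2)) => // j; exact: sqr_ge0.
have r_ge0 j : (0 <= r j)%E by exact: KKT_residual_ge0.
have [rate1 rate2] := best_residual_rate r_ge0 r_rho rho_sum.
split => //.
- apply: (enorm_cvg0 _ s_cvg (C := k)) => j; apply: le_trans (hk _) _.
  by rewrite ler_wpM2l ?(ltW k0)// /s lerDl.
- apply: (enorm_cvg0 _ s_cvg (C := k)) => j; apply: le_trans (hk _) _.
  by rewrite ler_wpM2l ?(ltW k0)// /s lerDr.
- apply: (@enorm_cvg0 _ _ _ (fun j => eps j.+1 ^+ 2 + s j.+1 + s j) Cl) => //.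
  rewrite -[X in _ --> X]addr0 -[X in _ --> X + _]addr0.
  apply: cvgD => //; apply: cvgD; first by rewrite (cvg_shiftS (fun j => eps j ^+ 2)).
  by rewrite (cvg_shiftS s).
Qed.
End ADMM.

Theorem theorem8 (R : realType) (n : nat) (hn : n = 2%N \/ n = 3%N)
  (* the domain, the family of meshes and the mesh T_h *)
  (Omega : set 'cV[R]_n) (hOmega : admissible_domain Omega)
  (H : Type) (Th : H -> triangulation R n)
  (hTh : regular_quasi_uniform Th)
  (hmesh : forall h, mesh_domain (Th h) `<=` Omega)
  (h : H)
  (* the nodal basis *)
  (N : nat) (node : 'I_N -> 'I_(nverts (Th h))) (phi : 'I_N -> 'cV[R]_n -> R)
  (hphi : nodal_basis Omega node phi)
  (* the elliptic form and the finite element matrices *)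
  (A : 'I_n -> 'I_n -> 'cV[R]_n -> R) (c0 : 'cV[R]_n -> R) (theta : R)
  (hA : elliptic_coefficients Omega A c0 theta)
  (K M W : 'M[R]_N)
  (hK : K = stiffness_matrix Omega A c0 phi)
  (hM : M = mass_matrix (Th h) phi)
  (hW : W = lumped_mass_matrix (Th h) phi)
  (* the optimal control problem *)
  (alpha beta a b : R) (yc yd : 'cV[R]_N)
  (halpha : 0 < alpha) (hbeta : 0 < beta) (ha : a < 0) (hb : 0 < b)
  (* the parameters of the method *)
  (sigma tau : R) (hsigma : 0 < sigma) (hsigma4 : sigma <= alpha / 4)
  (htau : 0 < tau) (htau1 : tau <= 1)
  (eps : nat -> R) (heps : forall k, 0 <= eps k) (hepscvg : cvgn (series eps))
  (* the KKT point and the initial point *)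
  (ys us zs ps lambdas : 'cV[R]_N)
  (hKKT : KKT_point K M W alpha beta a b yc yd ys us zs ps lambdas)
  (u0 z0 lambda0 : 'cV[R]_N) :
  exists C : R,
  forall delta u z lambda : nat -> 'cV[R]_N,
  u 0%N = u0 -> z 0%N = z0 -> lambda 0%N = lambda0 ->
  ihADMM K M W alpha beta a b yc yd sigma tau eps delta u z lambda ->
  let y := fun k => state K M yc (u k) in
  let p := fun k => adjoint_state K M yd (y k) in
  let r := fun k =>
    KKT_residual K M W alpha beta a b yc yd (u k) (z k) (lambda k) in
  [/\ (fun k => enorm (u k - us) + enorm (z k - zs)
                + enorm (lambda k - lambdas)) @ \oo --> (0 : R),
      (fun k => enorm (y k - ys) + enorm (p k - ps)) @ \oo --> (0 : R),
      forall k, (1 <= k)%N -> (best_residual r k <= (C / k%:R)%:E)%E &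
      (fun k => (k%:R)%:E * best_residual r k)%E @ \oo --> (0%E : \bar R)].
Proof.
have [oO bO cO] : [/\ open Omega, bounded_set Omega &
    convex_set (Omega : set (convex_lmodType 'cV[R]_n))] by case: hOmega.
have hmesh' := hmesh h.
have n_gt0 : (0 < n)%N by case: hn => ->.
have Msym : M^T = M by rewrite hM; exact: mass_sym.
have Wsym : W^T = W by rewrite hW tr_diag_mx.
have Mge0 x : 0 <= dot x (M *m x) by rewrite hM; exact: (mass_ge0 hphi).
have Mdef x : dot x (M *m x) = 0 -> x = 0 by rewrite hM; exact: (mass_definite hphi).
have MW x : dot x (M *m x) <= dot x (W *m x).
  by rewrite hM hW; exact: (mass_le_lumped hphi hmesh').
have WM x : dot x (W *m x) <= 8 * dot x (M *m x).
  by rewrite hM hW; exact: (lumped_le_mass hphi hmesh' x hn).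
have Kunit : K \in unitmx by rewrite hK; exact: (stiffness_unit hphi hmesh' oO hA n_gt0 bO cO).
have [Ky Kp grad0 sub0 uz] := hKKT; subst zs.
rewrite (gradientE K alpha yc yd Msym) in grad0.
have stat : grad_f K M alpha yc yd us + M *m lambdas = 0 by rewrite -grad0 addNr.
have [C hC] := admm_convergence Msym Wsym Mge0 Mdef MW WM halpha hbeta ha hb hsigma hsigma4
  htau htau1 heps hepscvg stat sub0 z0 lambda0.
exists C => delta u z lambda _ hz0 hl0 hADMM y p r.
have [u_cvg z_cvg l_cvg rate1 rate2] := hC delta u z lambda hz0 hl0 hADMM.
have ysE : ys = state K M yc us by rewrite /state -Ky mulKmx.
have psE : ps = adjoint_state K M yd ys by rewrite /adjoint_state -Kp mulKmx.
have yE k : y k - ys = (invmx K *m M) *m (u k - us).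
  rewrite ysE /y; have /= := state_shift K M yc us (u k - us); rewrite addrC subrK => ->.
  by rewrite addrC addKr.
have pE k : p k - ps = (- (invmx K *m M)) *m (y k - ys).
  rewrite psE /p /adjoint_state -!mulmxBr mulNmx -mulmxA -(mulmxN (invmx K) (M *m (y k - ys))) -(mulmxN M (y k - ys)).
  by congr (_ *m (_ *m _)); rewrite !opprB addrC addrA subrK.
have y_cvg : (fun k => enorm (y k - ys)) @ \oo --> (0 : R).
  by under eq_fun do rewrite yE; exact: enorm_mulmx_cvg0.
have p_cvg : (fun k => enorm (p k - ps)) @ \oo --> (0 : R).
  by under eq_fun do rewrite pE; exact: enorm_mulmx_cvg0.
split => //.
- have c := cvgD (cvgD u_cvg z_cvg) l_cvg.
  by rewrite !addr0 in c; exact: c.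
- have c := cvgD y_cvg p_cvg.
  by rewrite addr0 in c; exact: c.
Qed.
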